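(* Let $(\mathcal{R}_1, \mathrm{Ad}_{\Gamma_1})$ and $(\mathcal{R}_2, \mathrm{Ad}_{\Gamma_2})$ be central graded von Neumann algebras acting on Hilbert spaces $\mathcal{H}_1$, $\mathcal{H}_2$ respectively. If $\mathcal{R}_1$ is of type $\mathrm{I}_m$ ($m$ a cardinal number) and not a factor, and $\mathcal{R}_2$ is of type $\mathrm{I}_n$ ($n$ a cardinal number) and not a factor, then the graded tensor product $\mathcal{R}_1\hat{\otimes}\mathcal{R}_2$ is of type $\mathrm{I}_{2mn}$.
   Context: For a unitary $U$, $\mathrm{Ad}_U(x)=UxU^*$. A (spatially) graded von Neumann algebra $(\mathcal{R},\mathrm{Ad}_\Gamma)$ on a Hilbert space $\mathcal{H}$ is a von Neumann algebra $\mathcal{R}$ on $\mathcal{H}$ together with a self-adjoint unitary $\Gamma$ on $\mathcal{H}$ (the grading operator, not necessarily in $\mathcal{R}$) such that $\mathrm{Ad}_\Gamma(\mathcal{R})=\mathcal{R}$. For $\sigma=0,1$, $\mathcal{R}^{(\sigma)}=\{x\in\mathcal{R}: \Gamma x\Gamma=(-1)^\sigma x\}$; elements of $\mathcal{R}^{(0)}$ are even and elements of $\mathcal{R}^{(1)}$ are odd; an element of $\mathcal{R}^{(\sigma)}$ is called homogeneous of degree $\partial x=\sigma$. $Z(\mathcal{R})$ denotes the center of $\mathcal{R}$. $(\mathcal{R},\mathrm{Ad}_\Gamma)$ is central if $Z(\mathcal{R})\cap\mathcal{R}^{(0)}=\mathbb{C}I$. Graded tensor product: $\mathcal{R}_1\hat{\otimes}\mathcal{R}_2$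 is the von Neumann algebra on $\mathcal{H}_1\otimes\mathcal{H}_2$ generated by the operators $A\Gamma_1^{\partial B}\otimes B$ with $A\in\mathcal{R}_1$, $B\in\mathcal{R}_2$ homogeneous. A von Neumann algebra is of type $\mathrm{I}_n$, for a cardinal $n$ (finite or infinite), if its identity is the sum of an orthogonal family of $n$ mutually equivalent abelian projections. *)

(* Defs.v *)
From HB Require Import structures.
From mathcomp Require Import all_boot all_order all_algebra.
From mathcomp Require Import sesquilinear complex.
From mathcomp Require Import boolp classical_sets functions reals topology.
From mathcomp Require Import normedtype.
From mathcomp Require summability.

Set Implicit Arguments.
Unset Strict Implicit.
Unset Printing Implicit Defensive.
Import Order.TTheory GRing.Theory Num.Theory.
Local Open Scope classical_set_scope.
Local Open Scope ring_scope.

(* The inner product is linear in its first argument and conjugate-linear in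
   the second. *)
HB.mixin Record CompleteNormedModule_isHilbert (C : numClosedFieldType) H
    & CompleteNormedModule C H := {
  inner : {dot H for (@Num.conj C)} ;
  inner_normE : forall x : H, inner x x = `|x| ^+ 2 }.

#[short(type="hilbertType")]
HB.structure Definition Hilbert (C : numClosedFieldType) :=
  {H of CompleteNormedModule_isHilbert C H & CompleteNormedModule C H}.

Section Operators.
Context {C : numClosedFieldType} {H : hilbertType C}.
Implicit Types (A B T G p q v : H -> H) (M S : set (H -> H)).

Definition bounded_operator : set (H -> H) :=
  [set T | linear T /\ exists K : C, forall x, `|T x| <= K * `|x|].

(* B = A^*; the adjoint is unique, and by the Riesz representation theorem it
   exists for every bounded A. *)
Definition is_adjoint A B := forall x y, inner (A x) y = inner x (B y).

Definition commutant S : set (H -> H) :=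
  [set T | bounded_operator T /\ forall A, S A -> T \o A = A \o T].

(* M = M'' already makes M a unital subalgebra of B(H). *)
Definition von_neumann_algebra M :=
  [/\ M `<=` bounded_operator,
      forall A, M A -> exists2 B, M B & is_adjoint A B
    & commutant (commutant M) = M].

Definition vN_generated S : set (H -> H) := smallest von_neumann_algebra S.

Definition center M : set (H -> H) := M `&` commutant M.

Definition scalar_operators : set (H -> H) :=
  [set T | exists a : C, T = (fun x => a *: x)].

Definition is_factor M := von_neumann_algebra M /\ center M = scalar_operators.

(* A self-adjoint unitary: G^* = G, so that G G^* = G^* G = I is G G = I. *)
Definition grading_operator G :=
  [/\ bounded_operator G, is_adjoint G G & G \o G = id].

(* U x U^* for U = G a grading operator, where G^* = G. *)
Definition Ad G T : H -> H := G \o T \o G.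

Definition graded_von_neumann_algebra M G :=
  [/\ von_neumann_algebra M, grading_operator G & Ad G @` M = M].

(* s = false is the even part, s = true the odd part. *)
Definition graded_part M G (s : bool) : set (H -> H) :=
  [set T | M T /\ Ad G T = (fun x => (-1) ^+ s *: T x)].

Definition central_graded M G :=
  graded_von_neumann_algebra M G /\
  center M `&` graded_part M G false = scalar_operators.

Definition projection p :=
  [/\ bounded_operator p, is_adjoint p p & p \o p = p].

(* p M p is commutative. *)
Definition abelian_projection M p :=
  [/\ M p, projection p &
      forall A B, M A -> M B ->
        (p \o A \o p) \o (p \o B \o p) = (p \o B \o p) \o (p \o A \o p)].

(* Murray-von Neumann equivalence relative to M: w = v^*, p = v^* v and
   q = v v^* with v in M. *)
Definition equivalent_projections M p q :=
  exists v w, [/\ M v, M w, is_adjoint v w, w \o v = p & v \o w = q].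

(* A cardinal is represented by a type I of that cardinality.  The sum of the
   family is the strong limit of its finite partial sums; {classic I} only
   equips I with the choice structure needed to form finite subsets. *)
Definition type_I (I : Type) M :=
  von_neumann_algebra M /\
  exists p : {classic I} -> H -> H,
    [/\ forall i, abelian_projection M (p i),
        forall i j, i <> j -> p i \o p j = (fun=> 0),
        forall i j, equivalent_projections M (p i) (p j)
      & forall x, summability.partial_sum (fun i => p i x)
                    @ summability.totally --> x].

End Operators.

Section GradedTensorProduct.
Context {C : numClosedFieldType} {H1 H2 H : hilbertType C}.
Variable t : {bilinear H1 -> H2 -> H}.

(* (H, t) is a Hilbert space tensor product of H1 and H2, with t x y the
   elementary tensor of x and y; this determines (H, t) up to a unique unitary
   compatible with elementary tensors. *)
Definition hilbert_tensor_product :=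
  (forall x x' y y',
     inner (t x y) (t x' y') = inner x x' * inner y y') /\
  closure [set z : H | exists (k : nat) (x : 'I_k -> H1) (y : 'I_k -> H2),
                         z = \sum_(i < k) t (x i) (y i)] = setT.

(* T = A (x) B: a bounded operator is determined by its values on elementary
   tensors, which span a dense subspace. *)
Definition is_tensor_operator (A : H1 -> H1) (B : H2 -> H2) (T : H -> H) :=
  bounded_operator T /\ forall x y, T (t x y) = t (A x) (B y).

Definition graded_tensor_product (M1 : set (H1 -> H1)) (G1 : H1 -> H1)
    (M2 : set (H2 -> H2)) (G2 : H2 -> H2) : set (H -> H) :=
  vN_generated
    [set T | exists (A : H1 -> H1) (B : H2 -> H2) (s : bool),
       [/\ M1 A, graded_part M2 G2 s B
         & is_tensor_operator (A \o iter s G1) B T]].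

End GradedTensorProduct.

(* Main.v *)
Require Import Defs.
From mathcomp Require Import all_boot all_order all_algebra.
From mathcomp Require Import sesquilinear complex finmap.
From mathcomp Require Import boolp classical_sets functions reals topology.
From mathcomp Require Import normedtype sequences.
From mathcomp Require summability.
From mathcomp Require Import ring.

(** Let [M] be one of the two algebras, with grading [G].  Its even central
    elements are scalars but its centre is not, so there is a central [z] with
    [z^* = z], [z^2 = 1] and [G z G = - z], and the centre is [C 1 + C z]
    ([odd_reflection_exists], [center_half]).  The grading exchanges the central
    projections [e = (1 + z)/2] and [1 - e]: the algebra consists of two
    conjugate copies of the factor [M e], and its even part is isomorphic to
    [M e].  Thus [M1 (x)^ M2] is generated by the commuting even parts of [M1] and
    [M2], two factors of types I_m and I_n, together with [z1 (x) 1] and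
    [G1 (x) z2], two anticommuting self-adjoint unitaries that commute with both
    even parts and generate the two by two matrices.  This explains [2 m n].

    The proof exhibits the projections.  Let [(p i)] and [(q j)] be the given
    families of abelian projections.  Put [a s i = G1^s (p i) e1 G1^s] for [s] in
    [{0, 1}] and [r j = q j e2 + G2 (q j) e2 G2].  The [a s i] are orthogonal
    projections of [M1] with sum [1], and the [r j] are orthogonal even
    projections of [M2] with sum [1].  The family sought is [a s i (x) r j]
    ([transfer_total], [double_total], [sum_of_total]).  Two members are
    equivalent through tensor products of partial isometries, with [G1 (x) z2]
    as an additional factor if the values of [s] differ
    ([equivalent_in_graded_tensor]).

    Each [P = a s i (x) r j] is not only abelian but minimal: [P T P] is a scalar
    multiple of [P] for all [T] in the graded tensor product
    ([graded_tensor_minimal]).  Indeed [T] commutes with [A (x) 1] for even [A] in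
    [M1'], with [1 (x) B] for [B] in [M2'], and with [z1 (x) G2]
    ([graded_tensor_commute]).  So the operators obtained from
    [<T (x (x) y), x' (x) y'>] by fixing [y] and [y'] are compressed by [a s i] into
    [M1], and those obtained by fixing [x] and [x'] in the range of [a s i] are
    even elements of [M2]; and [a M1 a = C a], while [r B r] is in [C r] for even
    [B] in [M2].  These last two facts rest on [p M p = Z(M) p] for an abelian
    projection [p] ([abelian_center]).

    The analysis consists of the Riesz representation theorem, which provides
    adjoints, and of the principle [dense_operator], by which an operator given on
    a family with dense span is bounded as soon as it has a formal adjoint and its
    powers do not grow too fast on each vector of the family.  It yields both the
    operators [A (x) B] and the central element in [abelian_center]. *)

Set Implicit Arguments.
Unset Strict Implicit.
Unset Printing Implicit Defensive.
Import Order.TTheory GRing.Theory Num.Theory.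
Import numFieldNormedType.Exports.
Local Open Scope classical_set_scope.
Local Open Scope ring_scope.

(** * Inner products *)

Section InnerProduct.
Context {R : realType} {H : hilbertType R[i]}.
Implicit Types (x y z : H) (a : R[i]).

Lemma innerDl x y z : inner (x + y) z = inner x z + inner y z.
Proof. exact: linearDl. Qed.

Lemma innerDr x y z : inner z (x + y) = inner z x + inner z y.
Proof. exact: linearDr. Qed.

Lemma innerBl x y z : inner (x - y) z = inner x z - inner y z.
Proof. exact: linearBl. Qed.

Lemma innerBr x y z : inner z (x - y) = inner z x - inner z y.
Proof. exact: linearBr. Qed.

Lemma innerNl x y : inner (- x) y = - inner x y.
Proof. exact: linearNl. Qed.

Lemma innerNr x y : inner x (- y) = - inner x y.
Proof. exact: linearNr. Qed.

Lemma innerZl a x y : inner (a *: x) y = a * inner x y.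
Proof. exact: linearZl_LR. Qed.

Lemma innerZr a x y : inner x (a *: y) = a^* * inner x y.
Proof. exact: linearZr_LR. Qed.

Lemma inner_suml (I : Type) (s : seq I) (f : I -> H) y :
  inner (\sum_(i <- s) f i) y = \sum_(i <- s) inner (f i) y.
Proof. exact: linear_sumlz. Qed.

Lemma inner_sumr (I : Type) (s : seq I) (f : I -> H) y :
  inner y (\sum_(i <- s) f i) = \sum_(i <- s) inner y (f i).
Proof. exact: linear_sumr. Qed.

Lemma inner0l x : inner 0 x = 0 :> R[i].
Proof. exact: linear0l. Qed.

Lemma inner0r x : inner x 0 = 0 :> R[i].
Proof. exact: linear0r. Qed.

Lemma inner_conj x y : inner x y = (inner y x)^*.
Proof. by rewrite hermC expr0 mul1r. Qed.

Lemma inner_eq0 x : inner x x = 0 -> x = 0.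
Proof. by move/eqP; rewrite dnorm_eq0 => /eqP. Qed.

Lemma inner_ext x y : (forall z, inner x z = inner y z) -> x = y.
Proof.
move=> xy; apply/subr0_eq/inner_eq0.
by rewrite innerBl xy subrr.
Qed.

Lemma cauchy_schwarz x y : `|inner x y| <= `|x| * `|y|.
Proof.
have [->|y0] := eqVneq y 0; first by rewrite inner0r !normr0 mulr0.
have ny : 0 < `|y| ^+ 2 by rewrite exprn_gt0 // normr_gt0.
set z := `|y| ^+ 2 *: x - inner x y *: y.
have : 0 <= inner z z by rewrite inner_normE exprn_ge0.
have -> : inner z z = `|y| ^+ 2 * (`|x| ^+ 2 * `|y| ^+ 2 - `|inner x y| ^+ 2).
  rewrite /z !(innerBl, innerBr, innerZl, innerZr) !inner_normE normCK.
  rewrite (inner_conj y x) geC0_conj ?exprn_ge0 //.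
  by ring.
rewrite pmulr_rge0 // subr_ge0 -exprMn.
by rewrite ler_pXn2r // nnegrE ?mulr_ge0.
Qed.

End InnerProduct.

(** * Growth of powers *)

Section Growth.
Context {R : realType}.

(** For [f n = |S^n w|] with [S] symmetric, the growth of the powers of [S] at the
    single vector [w] yields [|S w| <= K |w|].  Log-convexity gives
    [f 1 ^ N * f 0 <= f N * f 0 ^ N] along [N = 2 ^ k]; an exponential rate
    above [K * f 0] for the left-hand side is excluded by letting [k] grow. *)
Lemma growth_bound (f : nat -> R) (K C : R) :
  (forall n, 0 <= f n) -> 0 <= K ->
  (forall n, f n ^+ 2 <= f (n + n)%N * f 0%N) ->
  (forall n, f n <= C * K ^+ n) -> f 1%N <= K * f 0%N.
Proof.
move=> f0 K0 ff fC.
have [f00|f0n0] := eqVneq (f 0%N) 0.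
  move: (ff 1%N); rewrite f00 !mulr0 => h.
  by rewrite -(@ler_pXn2r _ 2) ?nnegrE // expr0n.
have f0p : 0 < f 0%N by rewrite lt_def f0n0 f0.
have step k : f 1%N ^+ (2 ^ k) * f 0%N <= f (2 ^ k)%N * f 0%N ^+ (2 ^ k).
  elim: k => [|k IH]; first by rewrite !expr1.
  have {}IH : (f 1%N ^+ (2 ^ k) * f 0%N) ^+ 2 <=
              (f (2 ^ k)%N * f 0%N ^+ (2 ^ k)) ^+ 2.
    by rewrite ler_pXn2r // nnegrE mulr_ge0 ?exprn_ge0.
  rewrite -(ler_pM2r f0p) -mulrA -expr2 expnS mulnC exprM -exprMn.
  apply: (le_trans IH); rewrite exprMn exprM [leRHS]mulrAC.
  by rewrite ler_wpM2r ?exprn_ge0 // muln2 -addnn; exact: ff.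
rewrite leNgt; apply/negP => lt1.
have f1p : 0 < f 1%N by apply: le_lt_trans lt1; rewrite mulr_ge0.
pose q := K * f 0%N / f 1%N.
have q0 : 0 <= q by rewrite !mulr_ge0 ?invr_ge0.
have q1 : q < 1 by rewrite ltr_pdivrMr // mul1r.
have C0 : 0 <= C by have := fC 0%N; rewrite expr0 mulr1; apply: le_trans.
(* [k <= 2 ^ k] and [q < 1], so that the powers of two suffice *)
have bnd k : f 0%N <= C * q ^+ k.
  have : f 0%N <= C * q ^+ (2 ^ k).
    rewrite /q exprMn exprVn mulrA ler_pdivlMr ?exprn_gt0 // mulrC.
    apply: le_trans (step k) _.
    by rewrite exprMn mulrA ler_wpM2r ?exprn_ge0.
  move/le_trans; apply; rewrite ler_wpM2l //.
  apply: ler_wiXn2l => //; first exact: ltW.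
  exact/ltnW/ltn_expl.
have : (fun k => C * q ^+ k) @ \oo --> C * 0.
  by apply: cvgMr; apply: cvg_expr; rewrite ger0_norm.
rewrite mulr0 => lim0.
have : f 0%N <= 0.
  by apply: (ler_cvg_to (cvg_cst _) lim0); near=> k; exact: bnd.
by rewrite leNgt f0p.
Unshelve. all: by end_near. Qed.

Lemma invr_nat_lt (e : R) : 0 < e ->
  exists N, forall n, (N <= n)%N -> n.+1%:R^-1 < e.
Proof.
move=> e0; exists (Num.Def.archi_bound e^-1) => n hn.
rewrite invf_plt ?posrE //; apply: lt_trans (archi_boundP _) _.
  by rewrite invr_ge0 ltW.
by rewrite ltr_nat ltnS.
Qed.

End Growth.

(** * Norms with real values *)

Section RealNorm.
Context {R : realType} {H : hilbertType R[i]}.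

(** The norm taken in [R], where the order is total, complete and
    archimedean, instead of [R[i]]. *)
Definition nrm (x : H) : R := complex.Re `|x|.

Lemma nrmE (x : H) : `|x| = (nrm x)%:C%C.
Proof. by rewrite /nrm RRe_real ?normr_real. Qed.

Lemma nrm_ge0 (x : H) : 0 <= nrm x.
Proof. by rewrite -ler0c -nrmE. Qed.

Implicit Types (x y z : H).

Lemma nrmD x y : nrm (x + y) <= nrm x + nrm y.
Proof. by rewrite -lecR rmorphD /= -!nrmE ler_normD. Qed.

Lemma nrmB x y : nrm (x - y) = nrm (y - x).
Proof. by rewrite /nrm distrC. Qed.

Lemma nrmN x : nrm (- x) = nrm x.
Proof. by rewrite /nrm normrN. Qed.

Lemma nrm0 : nrm (0 : H) = 0.
Proof. by rewrite /nrm normr0. Qed.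

Lemma nrm0_eq0 x : nrm x = 0 -> x = 0.
Proof. by move=> x0; apply/normr0_eq0; rewrite nrmE x0. Qed.

Lemma nrmZ a x : nrm (a *: x) = complex.Re `|a| * nrm x.
Proof.
apply: (@complexI R); rewrite -nrmE normrZ (nrmE x) rmorphM.
by congr (_ * _); rewrite RRe_real ?normr_real.
Qed.

Lemma inner_nrm x : inner x x = (nrm x ^+ 2)%:C%C.
Proof. by rewrite inner_normE nrmE rmorphXn. Qed.

Lemma nrm_inner x y : complex.Re `|inner x y| <= nrm x * nrm y.
Proof.
rewrite -lecR RRe_real ?normr_real // (rmorphM (real_complex R)).
by have := cauchy_schwarz x y; rewrite !nrmE.
Qed.

Lemma cauchy_complete (u : nat -> H) :
  (forall e : R, 0 < e -> exists N, forall n m, (N <= n)%N -> (N <= m)%N ->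
     nrm (u n - u m) < e) ->
  exists l, forall e : R, 0 < e -> exists N, forall n, (N <= n)%N ->
     nrm (u n - l) < e.
Proof.
move=> cu.
have /cauchy_cvg cvgu : cauchy (u @ \oo).
  apply/cauchy_ballP => e e0.
  have eR : e = (complex.Re e)%:C%C by rewrite RRe_real // gtr0_real.
  have [|N hN] := cu (complex.Re e); first by rewrite -ltcR -eR.
  near=> p; rewrite -ball_normE /= nrmE eR ltcR.
  near: p; exists ([set u n | n in [set n | (N <= n)%N]],
                   [set u n | n in [set n | (N <= n)%N]]).
    by split; exists N => // n /= Nn; exists n.
  by move=> [x y] /= [[n Nn <-] [k Nk <-]]; exact: hN.
exists (lim (u @ \oo)) => e e0.
have /cvgrPdist_lt/(_ e%:C%C) : u @ \oo --> lim (u @ \oo) by [].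
rewrite ltcR => /(_ e0)[N _ hN]; exists N => n Nn.
by have := hN n Nn; rewrite /= nrmE ltcR nrmB.
Unshelve. all: by end_near. Qed.

End RealNorm.

Lemma nrm_le (R : realType) (E F : hilbertType R[i]) (k : R) (x : E) (y : F) :
  (nrm y <= k * nrm x) = (`|y| <= k%:C%C * `|x|).
Proof. by rewrite !nrmE -(rmorphM (real_complex R)) lecR. Qed.

(** * Riesz representation *)

Section RealPart.
Context {R : realType}.

Lemma ReD (a b : R[i]) : complex.Re (a + b) = complex.Re a + complex.Re b.
Proof. by case: a b => [? ?] []. Qed.

Lemma ReN (a : R[i]) : complex.Re (- a) = - complex.Re a.
Proof. by case: a. Qed.

Lemma ReZ (t : R) (a : R[i]) : complex.Re (t%:C%C * a) = t * complex.Re a.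
Proof. by case: a => p q /=; rewrite mul0r subr0. Qed.

Lemma Re_conj (a : R[i]) : complex.Re (a^*) = complex.Re a.
Proof. by case: a. Qed.

Lemma Re_le (a : R[i]) : `|complex.Re a| <= complex.Re `|a|.
Proof.
by rewrite -lecR RRe_real ?normr_real ?normc_ge_Re.
Qed.

Lemma Re_norm_ge0 (a : R[i]) : 0 <= complex.Re `|a|.
Proof. exact: le_trans (normr_ge0 _) (Re_le a). Qed.

(** A near-minimiser is nearly critical: [2 a] is, up to sign, the slope of a
    quadratic functional in some direction, at a point whose value exceeds the
    infimum by at most [c]. *)
Lemma quadratic_min (a b c : R) : 0 <= b ->
  (forall t : R, t * a *+ 2 <= c + t ^+ 2 * b) -> a ^+ 2 <= c * (b + 1).
Proof.
move=> b0 /(_ (a / (b + 1))) h.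
have b1 : 0 < b + 1 by rewrite ltr_wpDl.
rewrite -ler_pdivrMr //; set t := a / (b + 1) in h.
have -> : a ^+ 2 / (b + 1) = t * a by rewrite /t; ring.
have : t ^+ 2 * b <= t * a.
  have -> : t * a = t ^+ 2 * (b + 1) by rewrite /t; field; rewrite gt_eqF.
  by rewrite ler_wpM2l ?sqr_ge0 // lerDl.
move=> h2; rewrite -(lerD2r (t * a)) -mulr2n (le_trans h) //.
by rewrite lerD2l.
Qed.

End RealPart.

Section Riesz.
Context {R : realType} {H : hilbertType R[i]}.
Implicit Types (x y z : H).

Lemma nrmD_sqr x y :
  nrm (x + y) ^+ 2 = nrm x ^+ 2 + nrm y ^+ 2 + complex.Re (inner x y) *+ 2.
Proof.
have nE z : nrm z ^+ 2 = complex.Re (inner z z) by rewrite inner_nrm.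
by rewrite !nE !(innerDl, innerDr) !ReD (inner_conj y x) Re_conj; ring.
Qed.

(** The representing vector minimises [phi x = |x|^2 - 2 Re (f x)]: by the
    parallelogram law a minimising sequence is Cauchy, and the vanishing of the
    first variation at the limit [v] says [Re (f h) = Re <h, v>] for all [h];
    replacing [h] by [i h] yields the imaginary part. *)
Lemma riesz (f : H -> R[i]) (K : R) :
  (forall a x y, f (a *: x + y) = a * f x + f y) ->
  (forall x, `|f x| <= K%:C%C * `|x|) ->
  exists v, forall x, f x = inner x v.
Proof.
move=> flin fK.
have fD x y : f (x + y) = f x + f y by have := flin 1 x y; rewrite scale1r mul1r.
have f0 : f 0 = 0 by apply: (addrI (f 0)); rewrite -fD !addr0.
have fZ a x : f (a *: x) = a * f x by have := flin a x 0; rewrite f0 !addr0.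
pose phi x : R := nrm x ^+ 2 - complex.Re (f x) *+ 2.
have phiD x y : phi (x + y) = phi x + nrm y ^+ 2 -
   (complex.Re (f y) - complex.Re (inner x y)) *+ 2.
  by rewrite /phi nrmD_sqr fD ReD; ring.
have phi_lb x : - K ^+ 2 <= phi x.
  have : complex.Re (f x) <= K * nrm x.
    apply: le_trans (ler_norm _) _; apply: le_trans (Re_le _) _.
    by have := fK x; rewrite nrmE -rmorphM /= lecE /= => /andP[].
  move=> h; have := sqr_ge0 (nrm x - K).
  have -> : (nrm x - K) ^+ 2 = phi x + K ^+ 2 -
      (K * nrm x - complex.Re (f x)) *+ 2 by rewrite /phi; ring.
  rewrite subr_ge0 => h2; rewrite -subr_ge0 opprK; apply: le_trans h2.
  by rewrite mulrn_wge0 // subr_ge0.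
have hi : has_inf (range phi).
  by split; [exists (phi 0), 0 | exists (- K ^+ 2) => _ [x _ <-]].
pose mu := inf (range phi).
have mule x : mu <= phi x by apply: ge_inf; [case: hi | exists x].
have [u hu] : exists u : nat -> H, forall n, phi (u n) < mu + n.+1%:R^-1.
  suff /choice[u hu] : forall n : nat, exists x, phi x < mu + n.+1%:R^-1.
    by exists u.
  move=> n; have [||_ [x _ <-] hx] := @inf_adherent _ (range phi) n.+1%:R^-1.
  - by rewrite invr_gt0.
  - by [].
  - by exists x.
have par n m : nrm (u n - u m) ^+ 2 <= (n.+1%:R^-1 + m.+1%:R^-1) *+ 2.
  have h := mule (2^-1 *: (u n + u m)).
  have e1 : phi (2^-1 *: (u n + u m)) *+ 4 = (phi (u n) + phi (u m)) *+ 2 -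
     nrm (u n - u m) ^+ 2.
    rewrite /phi fZ fD nrmZ exprMn !nrmD_sqr.
    have -> : inner (u n) (- u m) = - inner (u n) (u m) by rewrite innerNr.
    have -> : nrm (- u m) = nrm (u m) by rewrite /nrm normrN.
    have -> : complex.Re `|2^-1 : R[i]| = 2^-1.
      by rewrite normfV (ger0_norm) // -(rmorph_nat (real_complex R)) -fmorphV.
    have -> : (2^-1 : R[i]) = (2^-1)%:C%C by rewrite fmorphV rmorph_nat.
    by rewrite ReZ ReN ReD; field.
  have := lerMn2r 4 mu (phi (2^-1 *: (u n + u m))); rewrite h orbT e1 => h2.
  rewrite -subr_ge0 in h2.
  rewrite -subr_ge0; apply: (le_trans h2); rewrite -subr_ge0.
  set A := nrm _ ^+ 2.
  have -> : (n.+1%:R^-1 + m.+1%:R^-1) *+ 2 - A -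
        ((phi (u n) + phi (u m)) *+ 2 - A - mu *+ 4) =
      (mu + n.+1%:R^-1 - phi (u n)) *+ 2 + (mu + m.+1%:R^-1 - phi (u m)) *+ 2.
    by ring.
  by rewrite addr_ge0 // mulrn_wge0 // subr_ge0 ltW.
have [v hv] : exists v, forall e : R, 0 < e -> exists N, forall n, (N <= n)%N ->
     nrm (u n - v) < e.
  apply: cauchy_complete => e e0.
  have [|N hN] := @invr_nat_lt R (e ^+ 2 / 4); first by rewrite divr_gt0 ?exprn_gt0.
  exists N => n m Nn Nm; rewrite -(@ltr_pXn2r _ 2) ?nnegrE ?nrm_ge0 ?(ltW e0) //.
  apply: le_lt_trans (par n m) _.
  have -> : e ^+ 2 = (e ^+ 2 / 4 + e ^+ 2 / 4) *+ 2 by field.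
  by rewrite ltrMn2r /= ltrD ?hN.
have reE h : complex.Re (f h) = complex.Re (inner h v).
  apply/eqP; rewrite -subr_eq0 -normr_le0; apply/ler_addgt0Pr => e e0; rewrite add0r.
  have h1 : 0 < nrm h ^+ 2 + 1 by rewrite ltr_wpDl ?exprn_ge0 ?nrm_ge0.
  have [|N1 hN1] := @invr_nat_lt R ((e / 2) ^+ 2 / (nrm h ^+ 2 + 1)).
    by rewrite divr_gt0 // exprn_gt0 // divr_gt0.
  have h2 : 0 < nrm h + 1 by rewrite ltr_wpDl ?nrm_ge0.
  have [|N2 hN2] := hv (e / 2 / (nrm h + 1)); first by rewrite !divr_gt0.
  pose n := maxn N1 N2.
  pose d := complex.Re (f h) - complex.Re (inner (u n) h).
  have dle : d ^+ 2 <= n.+1%:R^-1 * (nrm h ^+ 2 + 1).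
    apply: quadratic_min; rewrite ?exprn_ge0 ?nrm_ge0 // => t.
    have := mule (u n + t%:C%C *: h); rewrite phiD fZ innerZr ReZ nrmZ.
    have -> : (t%:C%C)^* = t%:C%C :> R[i] by exact: conjc_real.
    rewrite ReZ -mulrBr -/d exprMn => mle.
    have -> : t ^+ 2 = complex.Re `|t%:C%C| ^+ 2.
      by rewrite normc_def /= expr0n addr0 sqrtr_sqr real_normK ?num_real.
    move: mle (hu n); set w := _ * nrm h ^+ 2 => mle hun.
    rewrite -subr_ge0; have := subr_ge0 mu (phi (u n) + w - t * d *+ 2).
    rewrite mle => /le_trans; apply; rewrite -subr_ge0.
    have -> : n.+1%:R^-1 + w - t * d *+ 2 - (phi (u n) + w - t * d *+ 2 - mu)
      = mu + n.+1%:R^-1 - phi (u n) by ring.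
    by rewrite subr_ge0 ltW.
  have {}dle : `|d| <= e / 2.
    rewrite -(@ler_pXn2r _ 2) ?nnegrE ?divr_ge0 ?(ltW e0) //.
    rewrite real_normK ?num_real // (le_trans dle) //.
    by rewrite -ler_pdivlMr // ltW // hN1 // leq_maxl.
  have -> : complex.Re (f h) - complex.Re (inner h v) =
      d + complex.Re (inner (u n - v) h).
    by rewrite innerBl ReD ReN (inner_conj v h) Re_conj /d; ring.
  rewrite (le_trans (ler_normD _ _)) // [leRHS](_ : _ = e / 2 + e / 2); last by field.
  rewrite lerD // (le_trans (Re_le _)) // (le_trans (nrm_inner _ _)) //.
  rewrite (@le_trans _ _ (e / 2 / (nrm h + 1) * (nrm h + 1))) //.
    by rewrite ler_pM ?nrm_ge0 ?lerDl // ltW // hN2 // leq_maxr.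
  by rewrite divfK // gt_eqF.
exists v => x; apply/eqP; rewrite eq_complex reE eqxx /=.
have := reE ('i%C *: x); rewrite fZ innerZl.
by rewrite mulrC ReiNIm mulrC ReiNIm => /oppr_inj ->.
Qed.

End Riesz.

(** * Bounded maps and adjoints *)

Section BoundedMap.
Context {R : realType} {E F : hilbertType R[i]}.

(** The extension of [bounded_operator] to maps between different spaces. *)
Definition bounded_map (L : E -> F) :=
  linear L /\ exists K : R[i], forall x, `|L x| <= K * `|x|.

Variable (L : E -> F).
Hypothesis bL : bounded_map L.

Lemma bmapD x y : L (x + y) = L x + L y.
Proof. by have := bL.1 1 x y; rewrite !scale1r. Qed.

Lemma bmap0 : L 0 = 0.
Proof. by apply: (addrI (L 0)); rewrite -bmapD !addr0. Qed.

Lemma bmapZ a x : L (a *: x) = a *: L x.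
Proof. by have := bL.1 a x 0; rewrite bmap0 !addr0. Qed.

Lemma bmapN x : L (- x) = - L x.
Proof. by rewrite -scaleN1r bmapZ scaleN1r. Qed.

Lemma bmapB x y : L (x - y) = L x - L y.
Proof. by rewrite bmapD bmapN. Qed.

Lemma bmap_nrm : exists2 K : R, 0 < K & forall x, nrm (L x) <= K * nrm x.
Proof.
have [_ [K hK]] := bL.
exists (complex.Re `|K| + 1); first by rewrite ltr_wpDl ?Re_norm_ge0.
move=> x; have : nrm (L x) <= complex.Re `|K| * nrm x.
  rewrite nrm_le RRe_real ?normr_real // -(normr_id x) -normrM.
  by rewrite ger0_norm // (le_trans (normr_ge0 _) (hK x)).
move/le_trans; apply; rewrite mulrDl lerDl mul1r; exact: nrm_ge0.
Qed.

End BoundedMap.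

Section BoundedMaps.
Context {R : realType}.

Lemma bounded_map_nrm (E F : hilbertType R[i]) (L : E -> F) (K : R) :
  linear L -> (forall x, nrm (L x) <= K * nrm x) -> bounded_map L.
Proof.
move=> lL hK; split=> //; exists K%:C%C => x.
by rewrite -nrm_le.
Qed.

Lemma bounded_map_comp (E F G : hilbertType R[i]) (L : E -> F) (M : F -> G) :
  bounded_map L -> bounded_map M -> bounded_map (M \o L).
Proof.
move=> bL bM; have [K K0 hK] := bmap_nrm bL; have [K' K'0 hK'] := bmap_nrm bM.
apply: (@bounded_map_nrm _ _ _ (K' * K)).
  by move=> a x y /=; rewrite bL.1 bM.1.
move=> x /=; apply: le_trans (hK' _) _.
by rewrite -mulrA ler_wpM2l // ltW.
Qed.

Lemma bounded_mapD (E F : hilbertType R[i]) (L M : E -> F) :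
  bounded_map L -> bounded_map M -> bounded_map (fun x => L x + M x).
Proof.
move=> bL bM; have [K K0 hK] := bmap_nrm bL; have [K' K'0 hK'] := bmap_nrm bM.
apply: (@bounded_map_nrm _ _ _ (K + K')).
  by move=> a x y /=; rewrite bL.1 bM.1 scalerDr addrACA.
move=> x; apply: le_trans (nrmD _ _) _.
by rewrite mulrDl lerD.
Qed.

Lemma bounded_mapZ (E F : hilbertType R[i]) (a : R[i]) (L : E -> F) :
  bounded_map L -> bounded_map (fun x => a *: L x).
Proof.
move=> bL; have [K K0 hK] := bmap_nrm bL.
apply: (@bounded_map_nrm _ _ _ (complex.Re `|a| * K)).
  by move=> b x y /=; rewrite bL.1 scalerDr !scalerA mulrC.
move=> x; rewrite nrmZ -mulrA ler_wpM2l //.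
exact: Re_norm_ge0.
Qed.

Lemma bounded_map_id (E : hilbertType R[i]) : bounded_map (@id E).
Proof. by apply: (@bounded_map_nrm _ _ _ 1) => // x; rewrite mul1r. Qed.

Lemma bounded_mapB (E F : hilbertType R[i]) (L M : E -> F) :
  bounded_map L -> bounded_map M -> bounded_map (fun x => L x - M x).
Proof.
move=> bL bM.
have -> : (fun x => L x - M x) = (fun x => L x + (-1) *: M x).
  by apply/funext => x; rewrite scaleN1r.
exact/bounded_mapD/bounded_mapZ.
Qed.

(** [L' y] represents the functional [x |-> <L x, y>], and a bound of [L] is one
    of [L']. *)
Lemma adjoint_exists (E F : hilbertType R[i]) (L : E -> F) :
  bounded_map L ->
  exists2 L' : F -> E, bounded_map L' &
    forall x y, inner (L x) y = inner x (L' y).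
Proof.
move=> bL; have [K K0 hK] := bmap_nrm bL.
have ex y : exists v, forall x, inner (L x) y = inner x v.
  apply: (@riesz _ _ (fun x => inner (L x) y) (K * nrm y)).
    by move=> a x x'; rewrite bL.1 innerDl innerZl.
  move=> x; apply: le_trans (cauchy_schwarz _ _) _.
  rewrite (rmorphM (real_complex R)) mulrAC (nrmE y).
  by rewrite ler_wpM2r ?ler0c ?nrm_ge0 // -nrm_le.
have [L' hL'] := choice ex.
exists L' => [|x y]; last exact: hL'.
apply: (@bounded_map_nrm _ _ _ K).
  move=> a x y; apply: inner_ext => z; rewrite inner_conj -hL'.
  rewrite innerDr innerZr !hL' rmorphD rmorphM /= conjCK -!inner_conj.
  by rewrite innerDl innerZl.
move=> y; have [y0|y0] := eqVneq (nrm (L' y)) 0.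
  by rewrite y0 mulr_ge0 ?nrm_ge0 // ltW.
have y0' : 0 < nrm (L' y) by rewrite lt_def y0 nrm_ge0.
rewrite -(ler_pM2l y0') -expr2.
have -> : nrm (L' y) ^+ 2 = complex.Re (inner (L (L' y)) y).
  by rewrite hL' inner_nrm.
apply: le_trans (ler_norm _) _; apply: le_trans (Re_le _) _.
apply: le_trans (nrm_inner _ _) _.
by rewrite mulrA [_ * K]mulrC ler_wpM2r ?nrm_ge0.
Qed.

End BoundedMaps.

(** * Total families *)

Section ClosedSubspaces.
Context {R : realType}.

Definition closed_subspace (H : hilbertType R[i]) (W : set H) :=
  [/\ W 0, forall x y, W x -> W y -> W (x + y), forall a x, W x -> W (a *: x)
    & forall x, (forall e : R, 0 < e -> exists2 y, W y & nrm (x - y) < e) -> W x].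

(** The span of [a] is dense.  The quantification over closed subspaces makes
    it an induction principle: to prove a closed linear property everywhere, it
    is enough to prove it on the family. *)
Definition total (H : hilbertType R[i]) (J : Type) (a : J -> H) :=
  forall W, closed_subspace W -> (forall j, W (a j)) -> forall x, W x.

Lemma closed_subspace_preimage (E F : hilbertType R[i]) (L : E -> F) W :
  bounded_map L -> closed_subspace W -> closed_subspace (L @^-1` W).
Proof.
move=> bL [W0 WD WZ Wc]; split => /=.
- by rewrite (bmap0 bL).
- by move=> x y Wx Wy; rewrite (bmapD bL); exact: WD.
- by move=> a x Wx; rewrite (bmapZ bL); exact: WZ.
- have [K K0 hK] := bmap_nrm bL.
  move=> x hx; apply: Wc => e e0.
  have [|y Wy xy] := hx (e / K); first by rewrite divr_gt0.
  exists (L y) => //; rewrite -(bmapB bL); apply: le_lt_trans (hK _) _.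
  by rewrite mulrC -ltr_pdivlMr.
Qed.

Lemma closed_subspace0 (H : hilbertType R[i]) : closed_subspace [set (0 : H)].
Proof.
split=> //=.
- by move=> x y -> ->; rewrite addr0.
- by move=> a x ->; rewrite scaler0.
- move=> x hx; apply/nrm0_eq0/eqP; rewrite eq_le nrm_ge0 andbT.
  apply/ler_addgt0Pr => e e0; rewrite add0r; have [y -> ] := hx e e0.
  by rewrite subr0 => /ltW.
Qed.

Lemma bounded_map_ext (E F : hilbertType R[i]) (J : Type) (a : J -> E)
    (L M : E -> F) : total a -> bounded_map L -> bounded_map M ->
  (forall j, L (a j) = M (a j)) -> L = M.
Proof.
move=> ta bL bM LM; apply/funext => x; apply/subr0_eq.
have := closed_subspace_preimage (bounded_mapB bL bM) (closed_subspace0 F).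
by move=> /ta; apply => j /=; rewrite LM subrr.
Qed.

End ClosedSubspaces.

(** * Extension of operators from a dense span *)

Section Extension.
Context {R : realType} {E F : hilbertType R[i]} {J : Type}.

Definition lincomb (H : hilbertType R[i]) (g : J -> H) (s : seq (R[i] * J)) : H :=
  \sum_(cj <- s) cj.1 *: g cj.2.

Lemma lincomb_cat (H : hilbertType R[i]) (g : J -> H) s s' :
  lincomb g (s ++ s') = lincomb g s + lincomb g s'.
Proof. exact: big_cat. Qed.

Lemma lincomb_scale (H : hilbertType R[i]) (g : J -> H) c s :
  lincomb g [seq (c * cj.1, cj.2) | cj <- s] = c *: lincomb g s.
Proof.
rewrite /lincomb big_map scaler_sumr.
by apply: eq_bigr => cj _; rewrite scalerA.
Qed.

(** The graph of [L] is the closure [rel] of the set of the pairs formed by the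
    same combination of the [a j] and of the [b j]: the bound makes this closure
    single-valued, and completeness makes its domain closed. *)
Lemma bounded_extension (a : J -> E) (b : J -> F) (K : R) :
  total a -> (forall s, nrm (lincomb b s) <= K * nrm (lincomb a s)) ->
  exists2 L : E -> F, bounded_map L & forall j, L (a j) = b j.
Proof.
move=> ta hK0.
(* a positive bound, by which one can divide *)
pose K1 := `|K| + 1.
have K10 : 0 < K1 by rewrite ltr_wpDl.
have hK s : nrm (lincomb b s) <= K1 * nrm (lincomb a s).
  apply: le_trans (hK0 _) _; rewrite ler_wpM2r ?nrm_ge0 //.
  by rewrite ler_wpDr // ler_norm.
pose rel z w := forall e : R, 0 < e -> exists s,
  nrm (lincomb a s - z) < e /\ nrm (lincomb b s - w) < e.
have relD c z w z' w' : rel z w -> rel z' w' -> rel (c *: z + z') (c *: w + w').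
  move=> h h' e e0; pose k := complex.Re `|c| + 1.
  have k0 : 0 < k by rewrite ltr_wpDl ?Re_norm_ge0.
  have [|s [s1 s2]] := h (e / 2 / k); first by rewrite !divr_gt0.
  have [|s' [s1' s2']] := h' (e / 2); first by rewrite !divr_gt0.
  have aux (H : hilbertType R[i]) (u u' v v' : H) : nrm (u - v) < e / 2 / k ->
      nrm (u' - v') < e / 2 -> nrm (c *: u + u' - (c *: v + v')) < e.
    move=> uv uv'; have -> : c *: u + u' - (c *: v + v') = c *: (u - v) + (u' - v').
      by rewrite scalerBr opprD addrACA.
    apply: le_lt_trans (nrmD _ _) _.
    have -> : e = e / 2 / k * k + e / 2 by rewrite divfK ?gt_eqF //; field.
    apply: ler_ltD => //; rewrite nrmZ mulrC ler_pM ?nrm_ge0 ?Re_norm_ge0 //.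
      exact: ltW.
    by rewrite /k lerDl.
  exists ([seq (c * cj.1, cj.2) | cj <- s] ++ s').
  by rewrite !lincomb_cat !lincomb_scale; split; exact: aux.
have rel0 : rel 0 0 by move=> e e0; exists [::]; rewrite /lincomb !big_nil !subrr !nrm0.
have relZ c z w : rel z w -> rel (c *: z) (c *: w).
  by move=> /(relD c)/(_ rel0); rewrite !addr0.
have relN0 z w : rel z w -> nrm w <= K1 * nrm z.
  move=> zw; apply/ler_addgt0Pr => e e0.
  have [|s [s1 s2]] := zw (e / (K1 + 1)); first by rewrite divr_gt0 ?ltr_wpDl ?ltW.
  have -> : w = lincomb b s - (lincomb b s - w) by rewrite subKr.
  apply: le_trans (nrmD _ _) _; rewrite nrmN.
  apply: le_trans (lerD (hK _) (ltW s2)) _.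
  have -> : lincomb a s = z + (lincomb a s - z) by rewrite addrC subrK.
  apply: le_trans (lerD (ler_wpM2l (ltW K10) (nrmD _ _)) (lexx _)) _.
  rewrite mulrDr -addrA lerD2l.
  rewrite [leRHS](_ : _ = K1 * (e / (K1 + 1)) + e / (K1 + 1)); last first.
    by field; rewrite gt_eqF ?ltr_wpDl ?ltW.
  by rewrite lerD2r ler_wpM2l // ltW.
have relB z w z' w' : rel z w -> rel z' w' -> nrm (w - w') <= K1 * nrm (z - z').
  move=> h h'; apply: relN0; rewrite addrC [w - w']addrC -(scaleN1r z') -(scaleN1r w').
  exact: relD.
have W : forall z, exists w, rel z w.
  apply: (ta [set z | exists w, rel z w]) => [|j]; last first.
    exists (b j) => e e0; exists [:: (1, j)].
    by rewrite /lincomb !big_seq1 !scale1r !subrr !nrm0.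
  split=> /=.
  - by exists 0.
  - move=> x y [w xw] [w' yw']; exists (w + w').
    by have := relD 1 _ _ _ _ xw yw'; rewrite !scale1r.
  - by move=> c x [w xw]; exists (c *: w); exact: relZ.
  - move=> z hz.
    have /choice[u hu] : forall n : nat, exists xw : E * F,
        rel xw.1 xw.2 /\ nrm (z - xw.1) < n.+1%:R^-1.
      move=> n; have [|y [w yw] zy] := hz n.+1%:R^-1; first by rewrite invr_gt0.
      by exists (y, w).
    have [l hl] : exists l, forall e : R, 0 < e -> exists N, forall n, (N <= n)%N ->
        nrm ((u n).2 - l) < e.
      apply: cauchy_complete => e e0.
      have [|N hN] := @invr_nat_lt R (e / 2 / K1); first by rewrite !divr_gt0.
      exists N => n m Nn Nm; apply: le_lt_trans (relB _ _ _ _ (hu n).1 (hu m).1) _.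
      rewrite mulrC -ltr_pdivlMr //.
      have -> : (u n).1 - (u m).1 = ((u n).1 - z) + (z - (u m).1).
        by rewrite addrA subrK.
      apply: le_lt_trans (nrmD _ _) _; rewrite nrmB.
      have -> : e / K1 = e / 2 / K1 + e / 2 / K1 by field; rewrite gt_eqF.
      apply: ltrD.
        exact: lt_trans (hu n).2 (hN _ _).
      exact: lt_trans (hu m).2 (hN _ _).
    exists l => e e0.
    have [|N hN] := @invr_nat_lt R (e / 2); first by rewrite !divr_gt0.
    have [|N' hN'] := hl (e / 2); first by rewrite !divr_gt0.
    pose n := maxn N N'.
    have [|s [s1 s2]] := (hu n).1 (e / 2); first by rewrite !divr_gt0.
    have aux (H : hilbertType R[i]) (x y v : H) : nrm (x - y) < e / 2 ->
        nrm (y - v) < e / 2 -> nrm (x - v) < e.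
      move=> xy yv; have -> : x - v = (x - y) + (y - v) by rewrite addrA subrK.
      by apply: le_lt_trans (nrmD _ _) _; rewrite [e]splitr ltrD.
    exists s; split.
      apply: aux s1 _; rewrite nrmB; apply: lt_trans (hu n).2 (hN _ _).
      exact: leq_maxl.
    by apply: aux s2 _; apply: hN'; exact: leq_maxr.
have [L hL] := choice W.
have uniq z w : rel z w -> L z = w.
  move=> zw; apply/subr0_eq/nrm0_eq0/eqP; rewrite eq_le nrm_ge0 andbT.
  by have := relB _ _ _ _ (hL z) zw; rewrite subrr nrm0 mulr0.
exists L.
  apply: (@bounded_map_nrm _ _ _ _ K1) => [c x y|x]; last exact: relN0.
  by apply: uniq; exact: relD.
move=> j; apply: uniq => e e0; exists [:: (1, j)].
by rewrite /lincomb !big_seq1 !scale1r !subrr !nrm0.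
Qed.

End Extension.

Section DenseOperator.
Context {R : realType} {H : hilbertType R[i]} {J : Type}.
Variables (a : J -> H) (D D' : J -> J).
Hypothesis D_adj : forall j k, inner (a (D j)) (a k) = inner (a j) (a (D' k)).

Lemma lincomb_inner (g h g' h' : J -> H) s s' :
  (forall j k, inner (g j) (h k) = inner (g' j) (h' k)) ->
  inner (lincomb g s) (lincomb h s') = inner (lincomb g' s) (lincomb h' s').
Proof.
move=> gh; rewrite /lincomb !inner_suml; apply: eq_bigr => cj _.
rewrite !inner_sumr; apply: eq_bigr => cj' _.
by rewrite !(innerZl, innerZr) gh.
Qed.

Local Notation S := (D' \o D).

Lemma iter_adj n j k :
  inner (a (iter n S j)) (a k) = inner (a j) (a (iter n S k)).
Proof.
elim: n k => //= n IH k.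
rewrite inner_conj -D_adj -inner_conj D_adj IH.
by rewrite -[D' (D k)]/(S k) -iterSr.
Qed.

(** With [S = D' D], symmetric on the span, Cauchy-Schwarz gives
    [|D w|^2 = <S w, w> <= |S w| |w|] and [|S^n w|^2 <= |S^(2n) w| |w|].  So the
    growth of the powers of [S] on the family bounds [D] on the span. *)
Lemma dense_operator (K : R) : total a -> 0 <= K ->
  (forall j, exists C : R, forall n, nrm (a (iter n S j)) <= C * K ^+ n) ->
  exists2 T : H -> H, bounded_map T & forall j, T (a j) = a (D j).
Proof.
move=> ta K0 growth; apply: (@bounded_extension _ _ _ _ a (a \o D) (K + 1)) => // s.
pose f n := nrm (lincomb (a \o iter n S) s).
have nE (z : H) : nrm z ^+ 2 = complex.Re (inner z z) by rewrite inner_nrm.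
have hf : f 1%N <= K * f 0%N.
  have [C hC] : exists C : R, forall n, f n <= C * K ^+ n.
    rewrite /f; clear f; elim: s => [|cj s [C IH]].
      by exists 0 => n; rewrite /lincomb big_nil nrm0 mul0r.
    have [C' hC'] := growth cj.2.
    exists (complex.Re `|cj.1| * C' + C) => n; rewrite /lincomb big_cons.
    apply: le_trans (nrmD _ _) _; rewrite mulrDl; apply: lerD; last exact: IH.
    rewrite nrmZ -mulrA; apply: ler_wpM2l; first exact: Re_norm_ge0.
    exact: hC'.
  have ff n : f n ^+ 2 <= f (n + n)%N * f 0%N.
    rewrite nE (lincomb_inner (g' := a \o iter (n + n) S) (h' := a \o iter 0 S)).
      apply: le_trans (ler_norm _) _; apply: le_trans (Re_le _) _.
      exact: nrm_inner.
    by move=> j k /=; rewrite iterD [RHS]iter_adj.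
  by apply: (growth_bound _ K0 ff hC) => n; exact: nrm_ge0.
have hD : nrm (lincomb (a \o D) s) ^+ 2 <= K * f 0%N ^+ 2.
  rewrite nE (lincomb_inner (g' := a \o iter 1 S) (h' := a \o iter 0 S)); last first.
    move=> j k /=; rewrite -[D' (D j)]/(iter 1 S j) iter_adj /= D_adj.
    by [].
  apply: le_trans (ler_norm _) _; apply: le_trans (Re_le _) _.
  apply: le_trans (nrm_inner _ _) _.
  by rewrite expr2 mulrA ler_wpM2r ?nrm_ge0.
(* [K <= (K + 1) ^ 2] spares a square root *)
rewrite -(@ler_pXn2r _ 2) ?nnegrE ?mulr_ge0 ?nrm_ge0 ?addr_ge0 //.
apply: (le_trans hD); rewrite exprMn ler_wpM2r ?exprn_ge0 ?nrm_ge0 //.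
have -> : (K + 1) ^+ 2 = K + (K ^+ 2 + K + 1) by ring.
by rewrite lerDl !addr_ge0 ?exprn_ge0.
Qed.

End DenseOperator.

(** * Operators on a Hilbert space tensor product *)

Section Tensor.
Context {R : realType} {H1 H2 H : hilbertType R[i]}.
Variable t : {bilinear H1 -> H2 -> H}.
Hypothesis tH : hilbert_tensor_product t.

Lemma tensor_nrm x y : nrm (t x y) = nrm x * nrm y.
Proof.
apply/eqP; rewrite -(@eqrXn2 _ 2) ?mulr_ge0 ?nrm_ge0 //; apply/eqP.
apply: (@complexI R); rewrite -inner_nrm tH.1 !inner_nrm.
by rewrite -rmorphM exprMn.
Qed.

Lemma total_tensor : total (fun xy : H1 * H2 => t xy.1 xy.2).
Proof.
move=> W [W0 WD WZ Wc] Wt z; apply: Wc => e e0.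
have : closure [set z : H | exists (k : nat) (x : 'I_k -> H1) (y : 'I_k -> H2),
                         z = \sum_(i < k) t (x i) (y i)] z by rewrite tH.2.
move=> /(_ (ball z (e%:C%C)))[|w []].
  by apply: nbhsx_ballx; rewrite ltcR.
move=> [k [x [y ->]]] zw; exists (\sum_(i < k) t (x i) (y i)).
  apply: big_ind => // i _; exact: (Wt (x i, y i)).
by move: zw; rewrite -ball_normE /= nrmE ltcR.
Qed.

(** [D = (A, B)] acts on the index set of the elementary tensors, and the powers
    of [(A^* A, B^* B)] grow at most like those of the product of the bounds of
    [A^* A] and [B^* B]. *)
Lemma tensor_operator_exists (A : H1 -> H1) (B : H2 -> H2) :
  bounded_map A -> bounded_map B -> exists T, is_tensor_operator t A B T.
Proof.
move=> bA bB; have [A' bA' AA'] := adjoint_exists bA.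
have [B' bB' BB'] := adjoint_exists bB.
have [K K0 hK] := bmap_nrm (bounded_map_comp bA bA').
have [L L0 hL] := bmap_nrm (bounded_map_comp bB bB').
pose a (xy : H1 * H2) := t xy.1 xy.2.
have [] := @dense_operator _ _ _ a (fun xy => (A xy.1, B xy.2))
   (fun xy => (A' xy.1, B' xy.2)) _ (K * L) total_tensor.
- by move=> j k; rewrite /a /= !tH.1 AA' BB'.
- by rewrite mulr_ge0 // ltW.
- move=> j; exists (nrm j.1 * nrm j.2) => n; rewrite /a tensor_nrm.
  pose S (xy : H1 * H2) := (A' (A xy.1), B' (B xy.2)).
  have : forall p, nrm (iter n S p).1 <= nrm p.1 * K ^+ n /\
                   nrm (iter n S p).2 <= nrm p.2 * L ^+ n.
    move=> p; elim: n => [|n [IH1 IH2]] /=; first by rewrite !expr0 !mulr1.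
    by split; rewrite exprS mulrCA; apply: le_trans (ler_wpM2l (ltW _) _);
       try apply: hK; try apply: hL.
  move=> /(_ j)[h1 h2]; rewrite exprMn mulrACA.
  by apply: ler_pM; rewrite ?nrm_ge0.
move=> T bT hT; exists T; split=> // x y; exact: (hT (x, y)).
Qed.

Lemma tensor_operator_unique A B T T' :
  is_tensor_operator t A B T -> is_tensor_operator t A B T' -> T = T'.
Proof.
move=> [bT hT] [bT' hT'].
apply: (bounded_map_ext total_tensor (bT : bounded_map T) (bT' : bounded_map T')).
by move=> [x y] /=; rewrite hT hT'.
Qed.

End Tensor.

(** * Sums of orthogonal projections *)

Section Sums.
Context {R : realType} {H : hilbertType R[i]} {I : choiceType}.
Variable p : I -> H -> H.

Local Notation psum x := (summability.partial_sum (fun i => p i x)).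

Lemma psum_cvgP (u : {fset I} -> H) x :
  (u @ summability.totally --> x) <->
  forall e : R, 0 < e -> exists A : {fset I}, forall B : {fset I}, (A `<=` B)%fset ->
    nrm (x - u B) < e.
Proof.
have FF : Filter (@summability.totally I) by case: (@summability.totally_filter I).
split=> [/cvgrPdist_lt h e e0|h].
  have [|A _ hA] := h e%:C%C; first by rewrite ltcR.
  exists A => B AB; have := hA B AB.
  by rewrite /= nrmE ltcR.
apply/cvgrPdist_lt => e e0.
have eR : e = (complex.Re e)%:C%C by rewrite RRe_real // gtr0_real.
have [|A hA] := h (complex.Re e); first by rewrite -ltcR -eR.
by exists A => // B AB; rewrite nrmE eR ltcR hA.
Qed.

Lemma total_of_sum :
  (forall x, psum x @ summability.totally --> x) ->
  total (fun ix : I * H => p ix.1 ix.2).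
Proof.
move=> hp W [W0 WD WZ Wc] Wp x; apply: Wc => e e0.
have /psum_cvgP/(_ e e0)[A hA] := hp x.
exists (psum x A); last exact: hA.
by rewrite /summability.partial_sum; apply: big_ind => // i _; exact: (Wp (_, _)).
Qed.

Hypothesis pP : forall i, projection (p i).
Hypothesis po : forall i j, i <> j -> p i \o p j = (fun=> 0).

Lemma projection_nrm (q : H -> H) x : projection q -> nrm (q x) <= nrm x.
Proof.
move=> [bq qq q2]; have [q0|q0] := eqVneq (nrm (q x)) 0.
  by rewrite q0 nrm_ge0.
have q0' : 0 < nrm (q x) by rewrite lt_def q0 nrm_ge0.
rewrite -(ler_pM2l q0') -expr2.
have -> : nrm (q x) ^+ 2 = complex.Re (inner (q x) x).
  by rewrite -[in RHS]q2 /= qq inner_nrm.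
apply: le_trans (ler_norm _) _; apply: le_trans (Re_le _) _.
exact: nrm_inner.
Qed.

Lemma psumE x (A : {fset I}) : psum x A = \sum_(i <- A) p i x.
Proof. by rewrite /summability.partial_sum big_seq_fsetE. Qed.

Lemma psum_projection (A : {fset I}) : projection (fun x => psum x A).
Proof.
have bp i : bounded_map (p i) by case: (pP i).
have -> : (fun x => psum x A) = (fun x => \sum_(i <- A) p i x).
  by apply/funext => x; exact: psumE.
have bS (s : seq I) : bounded_map (fun x => \sum_(i <- s) p i x).
  elim: s => [|i s IH].
    apply: (@bounded_map_nrm _ _ _ _ 0) => [c x y|x]; rewrite !big_nil.
      by rewrite scaler0 addr0.
    by rewrite nrm0 mul0r.
  have -> : (fun x => \sum_(i <- i :: s) p i x) =
      (fun x => p i x + \sum_(i <- s) p i x).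
    by apply/funext => x; rewrite big_cons.
  exact: bounded_mapD.
split.
- exact: bS.
- move=> x y; rewrite inner_suml inner_sumr; apply: eq_bigr => i _.
  by case: (pP i).
- apply/funext => x /=; rewrite [in RHS]big_seq [LHS]big_seq; apply: eq_bigr => i iA.
  have -> : p i (\sum_(j <- A) p j x) = \sum_(j <- A) p i (p j x).
    elim: (enum_fset A) => [|j s IH]; first by rewrite !big_nil (bmap0 (bp i)).
    by rewrite !big_cons (bmapD (bp i)) IH.
  rewrite (big_fsetD1 i) //= [X in _ + X]big1_seq ?addr0.
    by have [_ _ /(congr1 (fun f => f x))] := pP i.
  move=> j /= ; rewrite in_fsetD1 => /andP[ji _].
  have ij : i <> j by move=> e; rewrite e eqxx in ji.
  exact: (congr1 (fun f => f x) (po ij)).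
Qed.

(** The vectors whose partial sums converge to themselves form a closed
    subspace, because the partial sums are projections, hence contractions; it
    contains the range of each [p i], on which the sums are eventually
    constant. *)
Lemma sum_of_total :
  total (fun ix : I * H => p ix.1 ix.2) ->
  forall x, psum x @ summability.totally --> x.
Proof.
move=> tp.
have bS A : bounded_map (fun x => psum x A) by case: (psum_projection A).
apply: (tp [set x | psum x @ summability.totally --> x]).
  split => /=.
  - apply/psum_cvgP => e e0; exists fset0 => B _.
    by rewrite (bmap0 (bS B)) subrr nrm0.
  - move=> x y /psum_cvgP hx /psum_cvgP hy; apply/psum_cvgP => e e0.
    have [|A hA] := hx (e / 2); first by rewrite divr_gt0.
    have [|A' hA'] := hy (e / 2); first by rewrite divr_gt0.
    exists (A `|` A')%fset => B; rewrite fsubUset => /andP[AB AB'].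
    rewrite (bmapD (bS B)) opprD addrACA; apply: le_lt_trans (nrmD _ _) _.
    by rewrite [e]splitr ltrD ?hA ?hA'.
  - move=> c x /psum_cvgP hx; apply/psum_cvgP => e e0.
    have k0 : 0 < complex.Re `|c| + 1 by rewrite ltr_wpDl ?Re_norm_ge0.
    have [|A hA] := hx (e / (complex.Re `|c| + 1)); first by rewrite divr_gt0.
    exists A => B /hA hB; rewrite (bmapZ (bS B)) -scalerBr nrmZ.
    apply: (@le_lt_trans _ _ ((complex.Re `|c| + 1) * nrm (x - psum x B))).
      by rewrite ler_wpM2r ?nrm_ge0 // lerDl.
    by rewrite mulrC -ltr_pdivlMr.
  - move=> x hx; apply/psum_cvgP => e e0.
    have [|y /psum_cvgP hy xy] := hx (e / 3); first by rewrite divr_gt0.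
    have [|A hA] := hy (e / 3); first by rewrite divr_gt0.
    exists A => B /hA hB.
    have -> : x - psum x B = (x - y) + (y - psum y B) + psum (y - x) B.
      by rewrite (bmapB (bS B)) [x - y + _]addrA subrK addrA subrK.
    apply: le_lt_trans (nrmD _ _) _; apply: le_lt_trans (lerD (nrmD _ _) (lexx _)) _.
    have -> : e = e / 3 + e / 3 + e / 3 by field.
    rewrite ltrD ?ltrD //; apply: le_lt_trans (projection_nrm _ (psum_projection B)) _.
    by rewrite nrmB.
move=> [i x] /=; apply/psum_cvgP => e e0.
exists [fset i]%fset => B; rewrite fsub1set => iB.
suff -> : psum (p i x) B = p i x by rewrite subrr nrm0.
rewrite psumE (big_fsetD1 i) //=.
rewrite [X in _ + X]big1_seq ?addr0.
  by have [_ _ /(congr1 (fun f => f x))] := pP i.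
move=> j /=; rewrite in_fsetD1 => /andP[ji _].
have ij : j <> i by move=> ee; rewrite ee eqxx in ji.
exact: (congr1 (fun f => f x) (po ij)).
Qed.

End Sums.

(** * Adjoints and commutants *)

Section Total.
Context {R : realType} {H : hilbertType R[i]}.

Lemma closed_subspace_ortho (y : H) : closed_subspace [set x : H | inner x y = 0].
Proof.
split=> /=.
- exact: inner0l.
- by move=> x x' x0 x'0; rewrite innerDl x0 x'0 addr0.
- by move=> a x x0; rewrite innerZl x0 mulr0.
- move=> x hx; apply/normr0_eq0; rewrite -[LHS]RRe_real ?normr_real //.
  suff -> : complex.Re `|inner x y| = 0 by [].
  apply/eqP; rewrite eq_le Re_norm_ge0 andbT; apply/ler_addgt0Pr => e e0; rewrite add0r.
  have y1 : 0 < nrm y + 1 by rewrite ltr_wpDl ?nrm_ge0.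
  have [|x' x'0 xx'] := hx (e / (nrm y + 1)); first by rewrite divr_gt0.
  rewrite -[inner x y]subr0 -x'0 -innerBl.
  apply: le_trans (nrm_inner _ _) _.
  apply: (@le_trans _ _ (e / (nrm y + 1) * (nrm y + 1))).
    by rewrite ler_pM ?nrm_ge0 ?lerDl // ltW.
  by rewrite divfK ?gt_eqF.
Qed.

Lemma total_inner_ext (J : Type) (a : J -> H) (y y' : H) : total a ->
  (forall j, inner (a j) y = inner (a j) y') -> y = y'.
Proof.
move=> ta h; apply/subr0_eq/inner_eq0.
by apply: (ta _ (closed_subspace_ortho _)) => j /=; rewrite innerBr h subrr.
Qed.

Lemma adjoint_unique (A B B' : H -> H) : is_adjoint A B -> is_adjoint A B' -> B = B'.
Proof.
move=> AB AB'; apply/funext => y; apply: inner_ext => z.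
by rewrite inner_conj -AB AB' -inner_conj.
Qed.

Lemma is_adjoint_sym (A B : H -> H) : is_adjoint A B -> is_adjoint B A.
Proof. by move=> AB x y; rewrite inner_conj -AB -inner_conj. Qed.

Lemma is_adjoint_comp (A A' B B' : H -> H) :
  is_adjoint A A' -> is_adjoint B B' -> is_adjoint (A \o B) (B' \o A').
Proof. by move=> AA' BB' x y /=; rewrite AA' BB'. Qed.

Lemma is_adjointD (A A' B B' : H -> H) : is_adjoint A A' -> is_adjoint B B' ->
  is_adjoint (fun x => A x + B x) (fun x => A' x + B' x).
Proof. by move=> AA' BB' x y; rewrite innerDl innerDr AA' BB'. Qed.

Lemma is_adjointZ a (A A' : H -> H) : is_adjoint A A' ->
  is_adjoint (fun x => a *: A x) (fun x => a^* *: A' x).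
Proof. by move=> AA' x y; rewrite innerZl innerZr conjCK AA'. Qed.

End Total.

Section VonNeumann.
Context {R : realType} {H : hilbertType R[i]}.
Implicit Types (A B T X : H -> H) (M S : set (H -> H)).

Lemma comp_eq (f g h k : H -> H) : f \o g = h \o k -> forall x, f (g x) = h (k x).
Proof. by move=> e x; exact: (congr1 (fun u => u x) e). Qed.

Lemma commutantP S T : commutant S T <->
  bounded_map T /\ forall A, S A -> forall x, T (A x) = A (T x).
Proof.
split=> -[bT hT]; split=> // A SA; first exact/comp_eq/hT.
by apply/funext => x; exact: hT.
Qed.

Lemma commutant_comp S A B : commutant S A -> commutant S B -> commutant S (A \o B).
Proof.
move=> /commutantP[bA hA] /commutantP[bB hB]; apply/commutantP.
split=> [|C SC x /=]; first exact: bounded_map_comp.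
by rewrite hB // hA.
Qed.

Lemma commutantD S A B : S `<=` bounded_operator ->
  commutant S A -> commutant S B -> commutant S (fun x => A x + B x).
Proof.
move=> Sb /commutantP[bA hA] /commutantP[bB hB]; apply/commutantP.
split=> [|C SC x /=]; first exact: bounded_mapD.
by rewrite hB // hA // (bmapD (Sb _ SC : bounded_map C)).
Qed.

Lemma commutantZ S a A : S `<=` bounded_operator ->
  commutant S A -> commutant S (fun x => a *: A x).
Proof.
move=> Sb /commutantP[bA hA]; apply/commutantP.
split=> [|C SC x /=]; first exact: bounded_mapZ.
by rewrite hA // (bmapZ (Sb _ SC : bounded_map C)).
Qed.

Lemma commutant_bounded S : commutant S `<=` bounded_operator.
Proof. by move=> T []. Qed.

Lemma commutant_adjoint S : (forall A, S A -> exists2 B, S B & is_adjoint A B) ->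
  forall T T', commutant S T -> is_adjoint T T' -> commutant S T'.
Proof.
move=> Sa T T' /commutantP[bT hT] TT'; apply/commutantP; split.
  have [T'' bT'' h''] := adjoint_exists bT.
  by rewrite (adjoint_unique TT' h'').
move=> A SA x; have [B SB AB] := Sa A SA; apply: inner_ext => z.
by rewrite (is_adjoint_sym TT') AB -hT // [RHS]AB (is_adjoint_sym TT').
Qed.

(** [S' = S'''] for every [S]; adjoints of elements of [S'] commute with adjoints
    of elements of [S]. *)
Lemma commutant_vN S : S `<=` bounded_operator ->
  (forall A, S A -> exists2 B, S B & is_adjoint A B) ->
  von_neumann_algebra (commutant S).
Proof.
move=> Sb Sa; split.
- exact: commutant_bounded.
- move=> T ST; have [T' _ TT'] := adjoint_exists (ST.1 : bounded_map T).
  by exists T' => //; exact: commutant_adjoint ST TT'.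
- apply/seteqP; split=> T.
    move=> /commutantP[bT hT]; apply/commutantP; split=> // A SA.
    apply: hT; apply/commutantP; split=> [|B /commutantP[_ hB] x]; first exact: Sb.
    by rewrite hB.
  move=> ST; apply/commutantP; split=> [|A /commutantP[_ hA] x]; first exact: ST.1.
  by rewrite hA.
Qed.

Lemma vN_commute M A B : M A -> commutant M B -> forall x, A (B x) = B (A x).
Proof. by move=> MA /commutantP[_ hB] x; rewrite hB. Qed.

Section Algebra.
Variable M : set (H -> H).
Hypothesis vM : von_neumann_algebra M.

Lemma vN_bounded A : M A -> bounded_map A.
Proof. by case: vM => Mb _ _ /Mb. Qed.

Lemma vN_commutantP T :
  M T <-> bounded_map T /\ forall A, commutant M A -> forall x, T (A x) = A (T x).
Proof. by case: vM => _ _ {1}<-; exact: commutantP. Qed.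

Lemma vN_comp A B : M A -> M B -> M (A \o B).
Proof. by case: vM => _ _ <-; exact: commutant_comp. Qed.

Lemma vND A B : M A -> M B -> M (fun x => A x + B x).
Proof. by case: vM => _ _ <-; apply: commutantD; exact: commutant_bounded. Qed.

Lemma vNZ a A : M A -> M (fun x => a *: A x).
Proof. by case: vM => _ _ <-; apply: commutantZ; exact: commutant_bounded. Qed.

Lemma vN_id : M id.
Proof. by apply/vN_commutantP; split=> //; exact: bounded_map_id. Qed.

Lemma vN_adjoint A B : M A -> is_adjoint A B -> M B.
Proof.
case: vM => _ Ma _ /Ma[B' MB' AB'] AB.
by rewrite (adjoint_unique AB AB').
Qed.

Lemma commutant_of_vN : von_neumann_algebra (commutant M).
Proof. by case: vM => Mb Ma _; exact: commutant_vN. Qed.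

End Algebra.

(** An intersection of bicommutants is its own bicommutant.  The commutant of
    the empty set consists of all bounded operators, so that the family which
    is intersected is not empty. *)
Lemma vN_generated_vN S : S `<=` bounded_operator ->
  von_neumann_algebra (vN_generated S).
Proof.
move=> Sb.
have vB : von_neumann_algebra (commutant (set0 : set (H -> H))).
  by apply: commutant_vN => A [].
have SB : S `<=` commutant (set0 : set (H -> H)) by move=> A /Sb bA; split=> // B [].
have gb : vN_generated S `<=` bounded_operator.
  by move=> A /(_ _ (conj vB SB)) [].
split=> //.
- move=> A gA; have [B _ AB] := adjoint_exists (gb _ gA : bounded_map A).
  by exists B => // M [vM SM]; apply: vN_adjoint AB => //; exact: gA.
- apply/seteqP; split=> T.
    move=> /commutantP[bT hT] M [vM SM]; apply/(vN_commutantP vM); split=> // A MA.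
    apply: hT; apply/commutantP; split=> [|B gB x]; first exact: MA.1.
    by rewrite (vN_commute (gB _ (conj vM SM)) MA).
  move=> gT; apply/commutantP; split=> [|A /commutantP[_ hA] x]; first exact: gb.
  by rewrite hA.
Qed.

(** [p M p = Z(M) p].  As [p M p] is commutative, [x = p X p] gives a well-defined
    and bounded operator [A p xi |-> A x xi] on the span of [M p H], by the
    principle [dense_operator] with [D = (A, x .)].  It commutes with [M] by
    construction, and with [M'] because [M'] commutes with [A], [p] and [x];
    hence it is central. *)
Lemma abelian_center M (p : H -> H) X : von_neumann_algebra M ->
  abelian_projection M p ->
  total (fun j : {A | M A} * H => sval j.1 (p j.2)) ->
  M X -> exists2 z, Defs.center M z & forall x, p (X (p x)) = z (p x).
Proof.
move=> vM [Mp [bp pp p2] pab] tp MX.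
have p2E y : p (p y) = p y by exact: (congr1 (fun f => f y) p2).
have [X' MX' XX'] : exists2 X', M X' & is_adjoint X X' by case: vM => _ /(_ _ MX).
pose a (j : {A | M A} * H) := sval j.1 (p j.2).
pose x := p \o X \o p; pose x' := p \o X' \o p.
have Mx : M x by apply: vN_comp => //; exact: vN_comp.
have Mx' : M x' by apply: vN_comp => //; exact: vN_comp.
have xx' : is_adjoint x x' by move=> u v; rewrite /x /x' /= pp XX' pp.
pose D (j : {A | M A} * H) := (j.1, x j.2).
pose D' (j : {A | M A} * H) := (j.1, x' j.2).
have Dadj j k : inner (a (D j)) (a k) = inner (a j) (a (D' k)).
  case: j k => -[A MA] u [[B MB] v]; rewrite /a /D /D' /=.
  have [A' MA' AA'] : exists2 A', M A' & is_adjoint A A' by case: vM => _ /(_ _ MA).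
  rewrite !AA' !pp XX' !pp !p2E; apply: (congr1 (inner u)).
  have := pab X' (A' \o B) MX' (vN_comp vM MA' MB).
  by move=> /(congr1 (fun f => f v)) /=; rewrite !p2E.
have [K K0 hK] := bmap_nrm (vN_bounded vM (vN_comp vM Mx' Mx)).
have [|T bT hT] := dense_operator Dadj tp (ltW K0).
  move=> [[A MA] u]; have [L L0 hL] := bmap_nrm (vN_bounded vM (vN_comp vM MA Mp)).
  exists (L * nrm u) => n.
  have -> : iter n (D' \o D) (exist _ A MA, u) = (exist _ A MA, iter n (x' \o x) u).
  by elim: n => //= n ->.
  apply: le_trans (hL _) _; rewrite -mulrA; apply: ler_wpM2l; first exact: ltW.
  elim: n => [|n IH]; first by rewrite expr0 mulr1.
  rewrite iterS exprS mulrCA; apply: le_trans (hK _) _.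
  by apply: ler_wpM2l => //; exact: ltW.
have hTE A u : M A -> T (A (p u)) = A (x u).
  by move=> MA; have := hT (exist _ A MA, u); rewrite /a /D /x /= p2E.
have cT : commutant M T.
  apply/commutantP; split=> // A MA u.
  have bA := vN_bounded vM MA.
  have e : T \o A = A \o T.
    apply: (bounded_map_ext tp (bounded_map_comp bA bT) (bounded_map_comp bT bA)).
    move=> [[B MB] v] /=; rewrite hTE //.
    by have := hTE _ v (vN_comp vM MA MB).
  exact: comp_eq e u.
exists T; last by move=> u; have := hTE _ u (vN_id vM).
split=> //; apply/(vN_commutantP vM); split=> // C cC u.
have bC : bounded_map C := cC.1.
have e : T \o C = C \o T.
  apply: (bounded_map_ext tp (bounded_map_comp bC bT) (bounded_map_comp bT bC)).
  move=> [[B MB] v] /=.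
  rewrite -(vN_commute MB cC) -(vN_commute Mp cC) !hTE //.
  by rewrite (vN_commute Mx cC) (vN_commute MB cC).
exact: comp_eq e u.
Qed.

End VonNeumann.

(** * Odd central reflections *)

Section Graded.
Context {R : realType} {H : hilbertType R[i]}.
Variables (M : set (H -> H)) (G : H -> H).
Hypothesis gM : graded_von_neumann_algebra M G.

Let vM : von_neumann_algebra M. Proof. by case: gM. Qed.

Lemma scale_half (v : H) : 2^-1 *: (v + v) = v.
Proof. by rewrite -mulr2n -(scaler_nat 2 v) scalerA mulVf ?scale1r ?pnatr_eq0. Qed.

Lemma grading_bounded : bounded_map G.
Proof. by case: gM => _ []. Qed.

Lemma grading_adjoint : is_adjoint G G.
Proof. by case: gM => _ []. Qed.

Lemma gradingK x : G (G x) = x.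
Proof. by case: gM => _ [_ _ /(congr1 (fun f => f x))]. Qed.

Lemma grading_stable A : M A -> M (G \o A \o G).
Proof. by case: gM => _ _ {2}<- MA; exists A. Qed.

Lemma grading_commutant B : commutant M B -> commutant M (G \o B \o G).
Proof.
move=> /commutantP[bB hB]; apply/commutantP; split.
  exact: bounded_map_comp grading_bounded (bounded_map_comp bB grading_bounded).
move=> A MA x /=; have := hB _ (grading_stable MA) (G x).
by rewrite /= !gradingK => ->; rewrite gradingK.
Qed.

Lemma center_comp y z : Defs.center M y -> Defs.center M z -> Defs.center M (y \o z).
Proof.
by move=> [My cy] [Mz cz]; split; apply: vN_comp => //; exact: commutant_of_vN.
Qed.

Lemma centerD y z : Defs.center M y -> Defs.center M z ->
  Defs.center M (fun x => y x + z x).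
Proof.
by move=> [My cy] [Mz cz]; split; apply: vND => //; exact: commutant_of_vN.
Qed.

Lemma centerZ a z : Defs.center M z -> Defs.center M (fun x => a *: z x).
Proof.
by move=> [Mz cz]; split; apply: vNZ => //; exact: commutant_of_vN.
Qed.

Lemma center_adjoint y z : Defs.center M y -> is_adjoint y z -> Defs.center M z.
Proof.
move=> [My cy] yz; split; apply: vN_adjoint yz => //; exact: commutant_of_vN.
Qed.

Lemma center_grading z : Defs.center M z -> Defs.center M (G \o z \o G).
Proof. by move=> [Mz cz]; split; [exact: grading_stable|exact: grading_commutant]. Qed.

Hypothesis cM : central_graded M G.

Lemma even_central_scalar z : Defs.center M z -> (forall x, G (z (G x)) = z x) ->
  exists a : R[i], forall x, z x = a *: x.
Proof.
move=> Zz ez.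
have : scalar_operators z.
  case: cM => _ <-; split=> //; split; first by case: Zz.
  by apply/funext => x; rewrite expr0 scale1r; exact: ez.
by move=> [a ->]; exists a.
Qed.

Definition odd_reflection z :=
  [/\ Defs.center M z, is_adjoint z z, forall x, z (z x) = x
    & forall x, G (z (G x)) = - z x].

(** The odd part [w] of a non-scalar central element is nonzero, and so is one of
    the self-adjoint odd elements [w + w'] and [i (w - w')], where [w'] is the
    adjoint of [w].  The square of such an element [h] is even and central, hence
    a scalar, which is positive because [<h h x, x> = |h x|^2]; it remains to
    normalise [h]. *)
Lemma odd_reflection_exists : ~ is_factor M -> exists z, odd_reflection z.
Proof.
move=> nf.
have odd_sa h : Defs.center M h -> is_adjoint h h -> (forall x, G (h (G x)) = - h x) ->
    forall x, h x <> 0 -> exists z, odd_reflection z.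
  move=> Zh hh oh x hx.
  have bh := vN_bounded vM Zh.1.
  have [c hc] : exists a : R[i], forall x, h (h x) = a *: x.
    apply: (even_central_scalar (center_comp Zh Zh)) => y /=.
    by rewrite -{1}[h (G y)]gradingK oh oh (bmapN bh) opprK.
  have xn0 : x <> 0 by move=> x0; apply: hx; rewrite x0 (bmap0 bh).
  have c0 : 0 < c.
    have pos (y : H) : y <> 0 -> 0 < inner y y.
      by move/eqP=> y0; rewrite inner_normE exprn_gt0 // normr_gt0.
    by have := pos _ hx; rewrite -hh hc innerZl pmulr_lgt0 // pos.
  pose a := (sqrtC c)^-1.
  have a0 : 0 <= a by rewrite invr_ge0 sqrtC_ge0 ltW.
  have aac : a * a * c = 1.
    by rewrite -expr2 exprVn sqrtCK mulVf // gt_eqF.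
  exists (fun x => a *: h x); split.
  - exact: centerZ.
  - by move=> u v; rewrite (is_adjointZ a hh) geC0_conj.
  - by move=> u; rewrite (bmapZ bh) scalerA hc scalerA aac scale1r.
  - by move=> u; rewrite (bmapZ grading_bounded) oh scalerN.
have [zeta Zz nz] : exists2 z, Defs.center M z & ~ scalar_operators z.
  apply: contrapT => h; apply: nf; split=> //; apply/seteqP; split=> z Zz.
    by apply: contrapT => nz; apply: h; exists z.
  by case: cM => _ e; move: Zz; rewrite -e => -[].
pose w x := zeta x + (-1) *: G (zeta (G x)).
have Zw : Defs.center M w.
  exact: (centerD Zz (centerZ (-1) (center_grading Zz))).
have bz := vN_bounded vM Zz.1.
have ow x : G (w (G x)) = - w x.
  rewrite /w (bmapD grading_bounded) (bmapZ grading_bounded) !gradingK.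
  by rewrite !scaleN1r opprD opprK addrC.
have [x wx] : exists x, w x <> 0.
  apply: contrapT => /forallNP h; apply: nz.
  have [x|a ha] := even_central_scalar Zz.
    have /contrapT := h x; rewrite /w scaleN1r => /subr0_eq.
    by [].
  by exists a; apply/funext.
clearbody w.
have [w' Mw' ww'] : exists2 w', M w' & is_adjoint w w' by case: vM => _ /(_ _ Zw.1).
have Zw' : Defs.center M w' := center_adjoint Zw ww'.
have ow' u : G (w' (G u)) = - w' u.
  apply: inner_ext => v; rewrite grading_adjoint (is_adjoint_sym ww') grading_adjoint.
  by rewrite ow innerNr innerNl (is_adjoint_sym ww').
have w'w := is_adjoint_sym ww'.
have [h|h] := pselect (w x + w' x = 0); last first.
  apply: (odd_sa (fun x => w x + w' x) (centerD Zw Zw') _ _ x h).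
  - move=> u v; apply: etrans (is_adjointD ww' w'w u v) _.
    exact: (congr1 (inner u) (addrC _ _)).
  - by move=> u; rewrite (bmapD grading_bounded) ow ow' opprD.
apply: (odd_sa (fun x => 'i *: (w x + (-1) *: w' x))
  (centerZ 'i (centerD Zw (centerZ (-1) Zw'))) _ _ x).
- move=> u v; rewrite (is_adjointZ 'i (is_adjointD ww' (is_adjointZ (-1) w'w))).
  apply: (congr1 (inner u)); rewrite rmorphN rmorph1 conjCi.
  rewrite !scaleN1r scaleNr -scalerN opprD opprK.
  by rewrite addrC.
- have bG := grading_bounded; move=> u; rewrite (bmapZ bG) (bmapD bG) (bmapZ bG).
  by rewrite ow ow' !scaleN1r opprK -scalerN opprD opprK.
- move/eqP; rewrite scaler_eq0 (negbTE (neq0Ci _)) /= scaleN1r subr_eq0 => /eqP wE.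
  move: h; rewrite -wE -mulr2n => /eqP; rewrite -scaler_nat scaler_eq0 pnatr_eq0 /=.
  by move/eqP.
Qed.

Section Halving.
Variable z : H -> H.
Hypothesis oz : odd_reflection z.

Let Zz : Defs.center M z. Proof. by case: oz. Qed.
Let zz x : z (z x) = x. Proof. by case: oz. Qed.
Let bz : bounded_map z. Proof. exact: (vN_bounded vM Zz.1). Qed.

Lemma reflection_grading x : z (G x) = - G (z x).
Proof.
by case: oz => _ _ _ h; rewrite -[LHS]gradingK h (bmapN grading_bounded).
Qed.

(** The central projection onto the eigenspace [z = 1]; the grading exchanges it
    with its complement. *)
Definition half x : H := 2^-1 *: (x + z x).

Lemma half_center : Defs.center M half.
Proof.
have Z1 : Defs.center M id.
  by split; [exact: vN_id|exact: (vN_id (commutant_of_vN vM))].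
exact: centerZ (centerD Z1 Zz).
Qed.

Lemma half_bounded : bounded_map half.
Proof. exact: (vN_bounded vM half_center.1). Qed.

Lemma half_reflection x : half (z x) = half x.
Proof. by rewrite /half zz addrC. Qed.

Lemma reflection_half x : z (half x) = half x.
Proof. by rewrite /half (bmapZ bz) (bmapD bz) zz addrC. Qed.

Lemma halfK x : half (half x) = half x.
Proof.
by rewrite -[LHS]/(2^-1 *: _) reflection_half scale_half.
Qed.

Lemma half_adjoint : is_adjoint half half.
Proof.
move=> x y; rewrite /half innerZl innerZr innerDl innerDr.
case: oz => _ -> _ _; congr (_ * _).
by rewrite geC0_conj // invr_ge0.
Qed.

Lemma half_grading x : half (G x) = G x - G (half x).
Proof.
rewrite /half (bmapZ grading_bounded) (bmapD grading_bounded) reflection_grading.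
by apply/eqP; rewrite eq_sym subr_eq -scalerDr addrACA addNr addr0 scale_half.
Qed.

Lemma half_grading_half x : half (G (half x)) = 0.
Proof. by rewrite half_grading halfK subrr. Qed.

Lemma half_commute A x : M A \/ commutant M A -> half (A x) = A (half x).
Proof.
case=> [MA|cA]; last by rewrite (vN_commute half_center.1 cA).
by rewrite (vN_commute MA half_center.2).
Qed.

(** [Z(M) e = C e]: the even part of [y] is a scalar, and its odd part times [z]
    is even and central, hence a scalar as well, while [z e = e]. *)
Lemma center_half y : Defs.center M y ->
  exists c : R[i], forall x, y (half x) = c *: half x.
Proof.
move=> Zy; have by' := vN_bounded vM Zy.1.
have Zg := center_grading Zy.
have [x|c hc] := even_central_scalar (centerD Zy Zg).
  by rewrite (bmapD grading_bounded) /= !gradingK addrC.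
have [x|d hd] := even_central_scalar
    (centerD (center_comp Zy Zz) (centerZ (-1) (center_comp Zg Zz))).
  rewrite /= !scaleN1r (bmapB grading_bounded) gradingK reflection_grading.
  by rewrite !(bmapN by', bmapN grading_bounded) gradingK opprK addrC.
exists (2^-1 * (c + d)) => x.
have := hd (half x); rewrite /= reflection_half scaleN1r => hd'.
have hc' := hc (half x).
by rewrite -scalerA scalerDl -hc' -hd' addrACA subrr addr0 scale_half.
Qed.

End Halving.
End Graded.

(** * Corners of a graded algebra *)

Section Corners.
Context {R : realType} {H : hilbertType R[i]}.
Variables (M : set (H -> H)) (G : H -> H).
Hypothesis cM : central_graded M G.
Variable z : H -> H.
Hypothesis oz : odd_reflection M G z.

Let gM : graded_von_neumann_algebra M G. Proof. by case: cM. Qed.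
Let vM : von_neumann_algebra M. Proof. by case: gM. Qed.
Let bG : bounded_map G := grading_bounded gM.
Let GK x : G (G x) = x := gradingK gM x.
Let Zz : Defs.center M z. Proof. by case: oz. Qed.

Local Notation e := (half z).

Let be : bounded_map e := half_bounded gM oz.
Let ee x : e (e x) = e x := halfK gM oz x.
Let eM A x : M A -> e (A x) = A (e x).
Proof. by move=> MA; exact: (half_commute gM oz x (or_introl MA)). Qed.

(** [G^s' A e G^s], with [e = half z].  Since [e G e = 0], these multiply like
    matrix units in the indices [s] and [s'] ([transfer_comp],
    [transfer_comp0]). *)
Definition transfer (s s' : bool) (A : H -> H) (x : H) : H :=
  iter s' G (A (e (iter s G x))).

(** [A e + G A e G], the even element with the same component as [A] in [M e].
    On [M] this is a homomorphism onto the even part. *)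
Definition double (A : H -> H) (x : H) : H :=
  transfer false false A x + transfer true true A x.

Lemma iter_gradingK (s : bool) x : iter s G (iter s G x) = x.
Proof. by case: s => //=. Qed.

Lemma iter_grading_bounded (s : bool) : bounded_map (iter s G).
Proof. by case: s => //=; exact: bounded_map_id. Qed.

Lemma iter_grading_adjoint (s : bool) : is_adjoint (iter s G) (iter s G).
Proof. by case: s => //=; exact: (grading_adjoint gM). Qed.

Lemma iter_grading_stable (s : bool) A : M A -> M (iter s G \o A \o iter s G).
Proof. by case: s => /= MA; [exact: (grading_stable gM)|exact: MA]. Qed.

Lemma iter_grading_commutant (s : bool) A :
  commutant M A -> commutant M (iter s G \o A \o iter s G).
Proof. by case: s => /= cA; [exact: (grading_commutant gM)|exact: cA]. Qed.

Lemma transfer_bounded s s' A : bounded_map A -> bounded_map (transfer s s' A).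
Proof.
move=> bA; exact: bounded_map_comp (bounded_map_comp (bounded_map_comp
  (iter_grading_bounded s) be) bA) (iter_grading_bounded s').
Qed.

Lemma transfer_in s A : M A -> M (transfer s s A).
Proof.
move=> MA; apply: (@iter_grading_stable s (A \o e)).
by apply: vN_comp => //; exact: (half_center gM oz).1.
Qed.

Lemma transfer_iter s s' A x :
  transfer s s' A x = transfer s' s' A (iter (s (+) s') G x).
Proof. by rewrite /transfer; case: s; case: s' => //=; rewrite GK. Qed.

Lemma transfer_adjoint s s' A A' : M A -> is_adjoint A A' ->
  is_adjoint (transfer s s' A) (transfer s' s A').
Proof.
move=> MA AA' x y; have MA' := vN_adjoint vM MA AA'.
rewrite /transfer iter_grading_adjoint AA' (half_adjoint oz) iter_grading_adjoint.
by rewrite eM.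
Qed.

Lemma transfer_comp s s' s'' A B x : M A ->
  transfer s' s'' B (transfer s s' A x) = transfer s s'' (B \o A) x.
Proof. by move=> MA; rewrite /transfer iter_gradingK eM // ee. Qed.

Lemma transfer_comp0 s s' t t' A B x : M A -> bounded_map B -> t != s' ->
  transfer t t' B (transfer s s' A x) = 0.
Proof.
move=> MA bB ts; rewrite /transfer.
have -> y : iter t G (iter s' G y) = G y.
  by case: t s' ts => -[].
rewrite -(eM _ MA) (half_grading_half gM oz) (bmap0 bB).
by case: t' => //=; rewrite (bmap0 bG).
Qed.

Lemma transfer_grading s s' A x :
  G (transfer s s' A (G x)) = transfer (~~ s) (~~ s') A x.
Proof. by rewrite /transfer; case: s; case: s' => /=; rewrite ?GK. Qed.

Lemma transfer0 s s' : transfer s s' (fun=> 0) = (fun=> 0).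
Proof. by apply/funext => x; rewrite /transfer (bmap0 (iter_grading_bounded s')). Qed.

Lemma double_in A : M A -> M (double A).
Proof. by move=> MA; exact: (vND vM (transfer_in false MA) (transfer_in true MA)). Qed.

Lemma double_adjoint A A' : M A -> is_adjoint A A' ->
  is_adjoint (double A) (double A').
Proof. by move=> MA AA'; apply: is_adjointD; exact: transfer_adjoint. Qed.

Lemma double_comp A B x : M A -> M B ->
  double B (double A x) = double (B \o A) x.
Proof.
move=> MA MB; have bB := vN_bounded vM MB.
rewrite /double !(bmapD (transfer_bounded _ _ bB)) !transfer_comp //.
by rewrite !transfer_comp0 // addr0 add0r.
Qed.

Lemma double_even A x : G (double A (G x)) = double A x.
Proof. by rewrite /double (bmapD bG) !transfer_grading addrC. Qed.

Lemma double0 : double (fun=> 0) = (fun=> 0).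
Proof. by apply/funext => x; rewrite /double !transfer0 addr0. Qed.

(** On the range of [G^s e G^s] only one of the two terms of [double A] survives. *)
Lemma double_half (s : bool) A x : M A ->
  double A (iter s G (e (iter s G x))) = transfer s s A x.
Proof.
move=> MA; have bA := vN_bounded vM MA.
rewrite -[iter s G _]/(transfer s s id x) /double.
have M1 := vN_id vM.
by case: s; rewrite transfer_comp // transfer_comp0 // ?addr0 ?add0r.
Qed.

Variables (I : Type) (p : I -> H -> H).
Hypothesis pab : forall i, abelian_projection M (p i).
Hypothesis po : forall i j, i <> j -> p i \o p j = (fun=> 0).
Hypothesis peq : forall i j, equivalent_projections M (p i) (p j).
Hypothesis ptot : total (fun ix : I * H => p ix.1 ix.2).

Let Mp i : M (p i). Proof. by case: (pab i). Qed.
Let bp i : bounded_map (p i). Proof. exact: (vN_bounded vM). Qed.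
Let pp i : is_adjoint (p i) (p i). Proof. by case: (pab i) => _ []. Qed.
Let pK i : p i \o p i = p i. Proof. by case: (pab i) => _ []. Qed.

(** [p j = v p i v^*] for a partial isometry [v] of [M], so that [M p i H]
    contains the range of each [p j]. *)
Lemma total_column i : total (fun j : {A | M A} * H => sval j.1 (p i j.2)).
Proof.
move=> W cW hW; apply: ptot => // -[j x] /=.
have [v [w [Mv Mw _ wv vw]]] := peq i j.
have -> : p j x = v (p i (w x)) by rewrite -(pK j) -vw -wv.
exact: (hW (exist _ v Mv, w x)).
Qed.

Lemma transfer_projection s i : projection (transfer s s (p i)).
Proof.
split; first exact: transfer_bounded.
- exact: transfer_adjoint.
- by apply/funext => x /=; rewrite transfer_comp // pK.
Qed.

Lemma transfer_orthogonal s i s' j : (s, i) <> (s', j) ->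
  transfer s s (p i) \o transfer s' s' (p j) = (fun=> 0).
Proof.
move=> ne; apply/funext => x /=; have [ss|ss] := eqVneq s s'; last first.
  by rewrite transfer_comp0.
rewrite -ss transfer_comp // po ?transfer0 //.
by move=> ij; apply: ne; rewrite ss ij.
Qed.

Lemma transfer_total :
  total (fun six : (bool * I) * H => transfer six.1.1 six.1.1 (p six.1.2) six.2).
Proof.
move=> W cW hW x.
have We y : W (e y).
  have := ptot (closed_subspace_preimage be cW); apply => -[i u] /=.
  by rewrite eM //; have := hW ((false, i), u).
have WG y : W (G (e y)).
  have bGe := bounded_map_comp be bG.
  have := ptot (closed_subspace_preimage bGe cW); apply => -[i u] /=.
  by rewrite eM //; have := hW ((true, i), G u); rewrite /transfer /= GK.
have -> : x = e x + G (e (G x)).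
  by rewrite (half_grading gM oz) (bmapB bG) !GK addrC subrK.
by case: cW => _ WD _ _; exact: WD.
Qed.

(** [p i A p i] belongs to [Z(M) p i] because [p i] is abelian, and
    [Z(M) e = C e]. *)
Lemma transfer_minimal s i A : M A -> exists c : R[i], forall x,
  transfer s s (p i) (A (transfer s s (p i) x)) = c *: transfer s s (p i) x.
Proof.
move=> MA; have MA' := iter_grading_stable s MA.
have [y Zy hy] := abelian_center vM (pab i) (@total_column i) MA'.
have [c hc] := center_half gM cM oz Zy.
exists c => x; rewrite /transfer.
have := hy (e (iter s G x)) => /= => h.
have := eM (p i (e (iter s G x))) MA' => /= h2.
by rewrite h2 eM // ee h -(eM _ (Mp i)) hc (bmapZ (iter_grading_bounded s)).
Qed.

Lemma iter_grading_reflection (s : bool) x :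
  z (iter s G x) = (-1) ^+ s *: iter s G (z x).
Proof.
case: s => /=; first by rewrite (reflection_grading gM oz) expr1 scaleN1r.
by rewrite expr0 scale1r.
Qed.

(** The commutant of the even part of [M'] is larger than [M], but compressing
    it to the eigenspaces of [z] leads back to [M]: as [z] belongs to [M'], an
    odd element [B] of [M'] is [(B z) z] with [B z] even, and [z] acts as a
    sign on the range of [es = G^s e G^s]. *)
Lemma transfer_minimal_even s i (Y : H -> H) : bounded_map Y ->
  (forall B, commutant M B -> (forall x, G (B (G x)) = B x) ->
     forall x, Y (B x) = B (Y x)) ->
  exists c : R[i], forall x,
    transfer s s (p i) (Y (transfer s s (p i) x)) = c *: transfer s s (p i) x.
Proof.
move=> bY hY; pose es := transfer s s id.
have M1 := vN_id vM.
have bes : bounded_map es by apply: transfer_bounded; exact: bounded_map_id.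
have sgn2 (v : H) : (-1) ^+ s *: ((-1) ^+ s *: v) = v.
  by rewrite scalerA -expr2 sqrr_sign scale1r.
have esz x : es (z x) = (-1) ^+ s *: es x.
  have gz : iter s G (z x) = (-1) ^+ s *: z (iter s G x).
    by rewrite iter_grading_reflection sgn2.
  rewrite /es /transfer gz (bmapZ be) (bmapZ (iter_grading_bounded s)).
  by rewrite (half_reflection oz).
have zes x : z (es x) = (-1) ^+ s *: es x.
  by rewrite /es /transfer iter_grading_reflection (reflection_half gM oz).
have esB B x : commutant M B -> es (B x) = B (es x).
  move=> cB; have cB' := iter_grading_commutant s cB.
  have := half_commute gM oz (iter s G x) (or_intror cB') => /=.
  by rewrite /es /transfer /= iter_gradingK => ->; rewrite iter_gradingK.
have es_tr x : es (transfer s s (p i) x) = transfer s s (p i) x.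
  exact: transfer_comp.
have tr_es x : transfer s s (p i) (es x) = transfer s s (p i) x.
  exact: transfer_comp.
clearbody es.
pose A y := es (Y (es y)).
have bA : bounded_map A := bounded_map_comp bes (bounded_map_comp bY bes).
have A_even B : commutant M B -> (forall x, G (B (G x)) = B x) ->
    forall x, A (B x) = B (A x).
  by move=> cB eB x; rewrite /A (esB B x cB) (hY B cB eB) (esB B _ cB).
have A_odd B : commutant M B -> (forall x, G (B (G x)) = - B x) ->
    forall x, A (B x) = B (A x).
  move=> cB oB x; have bB : bounded_map B by case: cB.
  have hYB := hY (B \o z) (commutant_comp cB Zz.2).
  rewrite /A (esB B x cB).
  have -> : B (es x) = (-1) ^+ s *: B (z (es x)) by rewrite zes (bmapZ bB) sgn2.
  rewrite (bmapZ bY) (bmapZ bes) (hYB _ (es x)) /=.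
    by rewrite (esB B _ cB) esz (bmapZ bB) sgn2.
  by move=> y /=; rewrite (reflection_grading gM oz) (bmapN bB) (bmapN bG) oB opprK.
have MA : M A.
  apply/(vN_commutantP vM); split=> // B cB x; have bB : bounded_map B by case: cB.
  have cg := grading_commutant gM cB.
  have vM' := commutant_of_vN vM.
  pose B0 x := B x + G (B (G x)); pose B1 x := B x + (-1) *: G (B (G x)).
  have BE y : B y = 2^-1 *: (B0 y + B1 y).
    by rewrite /B0 /B1 scaleN1r addrACA subrr addr0 scale_half.
  have e0 : A (B0 x) = B0 (A x).
    apply: A_even => [|y]; first exact: (vND vM' cB cg).
    by rewrite /B0 (bmapD bG) !GK addrC.
  have e1 : A (B1 x) = B1 (A x).
    apply: A_odd => [|y]; first exact: (vND vM' cB (vNZ vM' (-1) cg)).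
    by rewrite /B1 !scaleN1r (bmapB bG) !GK opprB.
  by rewrite (BE x) (BE (A x)) (bmapZ bA) (bmapD bA) e0 e1.
have [c hc] := transfer_minimal s i MA.
by exists c => x; rewrite -hc /A es_tr tr_es.
Qed.

Lemma double_projection i : projection (double (p i)).
Proof.
split; first exact: (vN_bounded vM (double_in (Mp i))).
- exact: double_adjoint.
- by apply/funext => x /=; rewrite double_comp // pK.
Qed.

Lemma double_orthogonal i j : i <> j -> double (p i) \o double (p j) = (fun=> 0).
Proof. by move=> ij; apply/funext => x /=; rewrite double_comp // po // double0. Qed.

Lemma double_total : total (fun ix : I * H => double (p ix.1) ix.2).
Proof.
move=> W cW hW; apply: transfer_total => // -[[s i] x] /=.
by rewrite -double_half //; exact: (hW (i, _)).
Qed.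

(** The off-diagonal terms vanish because [e B e'] does for [e' = 1 - e], and the
    two diagonal scalars agree because [G] exchanges the diagonal terms. *)
Lemma double_minimal i B : M B -> (forall x, G (B (G x)) = B x) ->
  exists c : R[i], forall x,
    double (p i) (B (double (p i) x)) = c *: double (p i) x.
Proof.
move=> MB eB; have [c hc] := transfer_minimal false i MB.
have bB := vN_bounded vM MB; exists c => x.
have GB y : B (G y) = G (B y) by rewrite -[LHS]GK eB.
have cross s s' y : s != s' -> transfer s s (p i) (B (transfer s' s' (p i) y)) = 0.
  move=> ss; have -> : B (transfer s' s' (p i) y) = transfer s' s' (B \o p i) y.
    by rewrite /transfer; case: s' {ss} => /=; rewrite ?GB.
  by rewrite transfer_comp0 //; exact: vN_comp.
have c1 y : transfer true true (p i) (B (transfer true true (p i) y)) =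
    c *: transfer true true (p i) y.
  by rewrite -!(transfer_grading false false) /= GB GK hc (bmapZ bG).
rewrite /double (bmapD bB) !(bmapD (transfer_bounded _ _ (bp i))).
by rewrite hc c1 !cross // addr0 add0r scalerDr.
Qed.

End Corners.

(** * Slices of operators on a tensor product *)

Section TensorOperators.
Context {R : realType} {H1 H2 H : hilbertType R[i]}.
Variable t : {bilinear H1 -> H2 -> H}.
Hypothesis tH : hilbert_tensor_product t.

Lemma tensor_operator_comp A B T A' B' T' :
  is_tensor_operator t A B T -> is_tensor_operator t A' B' T' ->
  is_tensor_operator t (A \o A') (B \o B') (T \o T').
Proof.
move=> [bT hT] [bT' hT']; split; first exact: (bounded_map_comp bT' bT).
by move=> x y /=; rewrite hT' hT.
Qed.

Lemma tensor_operator_adjoint A A' B B' T T' :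
  is_tensor_operator t A B T -> is_tensor_operator t A' B' T' ->
  is_adjoint A A' -> is_adjoint B B' -> is_adjoint T T'.
Proof.
move=> [bT hT] [bT' hT'] AA' BB'.
have [T'' bT'' TT''] := adjoint_exists (bT : bounded_map T).
suff <- : T'' = T' by [].
apply: (bounded_map_ext (total_tensor tH) bT'' (bT' : bounded_map T')) => -[x y] /=.
apply: (total_inner_ext (total_tensor tH)) => -[x' y'] /=.
by rewrite -TT'' hT hT' !tH.1 AA' BB'.
Qed.

Lemma tensor_left_bounded y : bounded_map (fun x => t x y).
Proof.
apply: (@bounded_map_nrm _ _ _ _ (nrm y)) => [a u v|x].
  by rewrite linearDl linearZl_LR.
by rewrite (tensor_nrm tH) mulrC.
Qed.

Lemma tensor_right_bounded x : bounded_map (t x).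
Proof.
apply: (@bounded_map_nrm _ _ _ _ (nrm x)) => [a u v|y].
  by rewrite linearDr linearZr_LR.
by rewrite (tensor_nrm tH).
Qed.

(** [Y = L'^* T L]; for [L x = t x y] and [L' x = t x y'] these are the slices of
    [T] along the second factor. *)
Lemma sesquilinear_slice (E : hilbertType R[i]) (L L' : E -> H) (T : H -> H) :
  bounded_map L -> bounded_map L' -> bounded_map T ->
  exists2 Y : E -> E, bounded_map Y &
    forall x x', inner (Y x) x' = inner (T (L x)) (L' x').
Proof.
move=> bL bL' bT; have [L'' bL'' LL''] := adjoint_exists bL'.
exists (L'' \o (T \o L)).
  exact: bounded_map_comp (bounded_map_comp bL bT) bL''.
by move=> x x' /=; rewrite inner_conj -LL'' -inner_conj.
Qed.

Lemma commute_tensor_inner A A' B B' (S T : H -> H) :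
  is_tensor_operator t A B S -> is_adjoint A A' -> is_adjoint B B' ->
  bounded_map A' -> bounded_map B' -> (forall w, T (S w) = S (T w)) ->
  forall x y x' y',
    inner (T (t (A x) (B y))) (t x' y') = inner (T (t x y)) (t (A' x') (B' y')).
Proof.
move=> hS AA' BB' bA' bB' TS x y x' y'.
have [S' hS'] := tensor_operator_exists tH bA' bB'.
by rewrite -hS.2 -hS'.2 TS (tensor_operator_adjoint hS hS').
Qed.

End TensorOperators.

(** * Compressions of the graded tensor product *)

Section GradedTensor.
Context {R : realType} {H1 H2 H : hilbertType R[i]}.
Variable t : {bilinear H1 -> H2 -> H}.
Hypothesis tH : hilbert_tensor_product t.
Variables (M1 : set (H1 -> H1)) (G1 : H1 -> H1).
Variables (M2 : set (H2 -> H2)) (G2 : H2 -> H2).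
Hypotheses (c1 : central_graded M1 G1) (c2 : central_graded M2 G2).

Let g1 : graded_von_neumann_algebra M1 G1. Proof. by case: c1. Qed.
Let g2 : graded_von_neumann_algebra M2 G2. Proof. by case: c2. Qed.
Let v1 : von_neumann_algebra M1. Proof. by case: g1. Qed.
Let v2 : von_neumann_algebra M2. Proof. by case: g2. Qed.

Local Notation N := (graded_tensor_product t M1 G1 M2 G2).

Lemma graded_tensor_vN : von_neumann_algebra N.
Proof. by apply: vN_generated_vN => T [A [B [s [_ _ []]]]]. Qed.

Lemma graded_tensor_in A B s T : M1 A -> graded_part M2 G2 s B ->
  is_tensor_operator t (A \o iter s G1) B T -> N T.
Proof. by move=> MA MB hT M [_]; apply; exists A, B, s. Qed.

Variables (z1 : H1 -> H1).
Hypothesis o1 : odd_reflection M1 G1 z1.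

(** The pairs for which [A (x) B] will be shown to commute with the graded tensor
    product.  In [z1 (x) G2] the sign of [z1] against [G1] compensates the sign
    of [G2] against an odd element of [M2]. *)
Definition graded_commuting (A : H1 -> H1) (B : H2 -> H2) : Prop :=
  [\/ [/\ B = id, commutant M1 A & forall x, G1 (A (G1 x)) = A x],
      A = id /\ commutant M2 B
    | A = z1 /\ B = G2].

Lemma graded_commuting_bounded A B : graded_commuting A B ->
  bounded_map A /\ bounded_map B.
Proof.
case=> [[-> [bA _] _]|[-> [bB _]]|[-> ->]]; split => //; try exact: bounded_map_id.
  by apply: (vN_bounded v1); case: o1 => -[].
exact: grading_bounded g2.
Qed.

Lemma graded_commuting_adjoint A B : graded_commuting A B ->
  exists A' B', [/\ graded_commuting A' B', is_adjoint A A' & is_adjoint B B'].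
Proof.
case=> [[-> cA eA]|[-> cB]|[-> ->]].
- have [A' _ AA'] := adjoint_exists (cA.1 : bounded_map A).
  exists A', id; split=> //; constructor 1; split=> //.
    by apply: vN_adjoint AA' => //; exact: commutant_of_vN.
  move=> x; apply: inner_ext => y.
  rewrite (grading_adjoint g1) (is_adjoint_sym AA') (grading_adjoint g1).
  by rewrite eA (is_adjoint_sym AA').
- have [B' _ BB'] := adjoint_exists (cB.1 : bounded_map B).
  exists id, B'; split=> //; constructor 2; split=> //.
  by apply: vN_adjoint BB' => //; exact: commutant_of_vN.
- exists z1, G2; split; first by constructor 3.
    by case: o1.
  exact: grading_adjoint g2.
Qed.

(** The set [X] of these operators is closed under adjoints, so [X'] is a von
    Neumann algebra; it contains the generators. *)
Lemma graded_tensor_commute A B S T : graded_commuting A B ->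
  is_tensor_operator t A B S -> N T -> forall w, T (S w) = S (T w).
Proof.
move=> gAB hS NT.
pose X : set (H -> H) :=
  [set S | exists A B, graded_commuting A B /\ is_tensor_operator t A B S].
have vX : von_neumann_algebra (commutant X).
  apply: commutant_vN => [S' [A' [B' [_ []]]] //|S' [A' [B' [gAB' hS']]]].
  have [A'' [B'' [gAB'' AA BB]]] := graded_commuting_adjoint gAB'.
  have [bA bB] := graded_commuting_bounded gAB''.
  have [S'' hS''] := tensor_operator_exists tH bA bB.
  exists S''; first by exists A'', B''.
  exact: (tensor_operator_adjoint tH hS' hS'').
have XT : commutant X T.
  apply: (NT (commutant X)); split=> // {T NT}T [C [D [s [MC [MD eD] hT]]]].
  apply/commutantP; split=> [|S' [A' [B' [gAB' hS']]]]; first exact: hT.1.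
  suff e : T \o S' = S' \o T by move=> w; exact: comp_eq e w.
  have h1 := tensor_operator_comp hT hS'.
  have h2 := tensor_operator_comp hS' hT.
  apply: (bounded_map_ext (total_tensor tH) h1.1 h2.1) => -[x y].
  rewrite h1.2 h2.2 /=.
  case: gAB' => [[-> cA' eA']|[-> cB']|[-> ->]].
  - congr (t _ _); rewrite -(vN_commute MC cA'); congr (C _).
    case: s {MD eD hT h1 h2} => //=.
    by rewrite -[RHS](gradingK g1) eA'.
  - by congr (t _ _); rewrite (vN_commute MD cB').
  - have z1M : commutant M1 z1 by case: o1 => -[].
    rewrite -(vN_commute MC z1M) (iter_grading_reflection c1 o1).
    rewrite (bmapZ (vN_bounded v1 MC)) linearZl_LR.
    have -> : D (G2 y) = (-1) ^+ s *: G2 (D y).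
      have := congr1 (fun f => f y) eD; rewrite /Ad /=.
      by move=> h; rewrite -[LHS](gradingK g2) h (bmapZ (grading_bounded g2)).
    by rewrite linearZr_LR.
have [_ /(_ S)] := (commutantP X T).1 XT.
by apply; exists A, B.
Qed.

Lemma graded_tensor_inner A B T : graded_commuting A B -> N T ->
  exists A' B', [/\ is_adjoint A A', is_adjoint B B' & forall x y x' y',
    inner (T (t (A x) (B y))) (t x' y') = inner (T (t x y)) (t (A' x') (B' y'))].
Proof.
move=> gAB NT; have [A' [B' [gAB' AA' BB']]] := graded_commuting_adjoint gAB.
have [bA bB] := graded_commuting_bounded gAB.
have [bA' bB'] := graded_commuting_bounded gAB'.
have [S hS] := tensor_operator_exists tH bA bB.
exists A', B'; split=> //.
by apply: (commute_tensor_inner tH hS) => //; exact: graded_tensor_commute hS NT.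
Qed.

Variables (z2 : H2 -> H2).
Hypothesis o2 : odd_reflection M2 G2 z2.
Variables (I J : Type) (p : I -> H1 -> H1) (q : J -> H2 -> H2).
Hypothesis pab : forall i, abelian_projection M1 (p i).
Hypothesis peq : forall i j, equivalent_projections M1 (p i) (p j).
Hypothesis ptot : total (fun ix : I * H1 => p ix.1 ix.2).
Hypothesis qab : forall i, abelian_projection M2 (q i).
Hypothesis qeq : forall i j, equivalent_projections M2 (q i) (q j).
Hypothesis qtot : total (fun ix : J * H2 => q ix.1 ix.2).

Local Notation a s i := (transfer G1 z1 s s (p i)).
Local Notation r j := (double G2 z2 (q j)).

Let Mp i : M1 (p i). Proof. by case: (pab i). Qed.

(** The slice of [T] with [y] and [y'] fixed commutes with the even part of
    [M1']. *)
Lemma first_slice s i T y y' : N T -> exists c, forall x x',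
  inner (T (t (a s i x) y)) (t (a s i x') y') = c * inner (a s i x) x'.
Proof.
move=> NT; have bT : bounded_map T := vN_bounded graded_tensor_vN NT.
have bt := tensor_left_bounded tH.
have [Y bY hY] := sesquilinear_slice (bt y) (bt y') bT.
have [|c hc] := transfer_minimal_even c1 o1 pab peq ptot s i bY.
  move=> B cB eB x; apply: inner_ext => x'; rewrite hY.
  have gB : graded_commuting B id by constructor 1.
  have [A' [B' [BA' iB' h]]] := graded_tensor_inner gB NT.
  have -> : t (B x) y = t (B x) (id y) by [].
  rewrite h -(adjoint_unique (fun u v => erefl (inner u v)) iB') /=.
  by rewrite -hY BA'.
have [_ aa _] := transfer_projection c1 o1 pab s i.
by exists c => x x'; rewrite -innerZl -hc aa hY.
Qed.

(** The slice of [T] with [x] and [x'] fixed commutes with [M2'], hence belongs to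
    [M2].  It is even: [z1] acts as a sign on [a s i x] and [a s i x'], so
    that [z1 (x) G2] acts there as [1 (x) G2] up to a sign which occurs
    twice. *)
Lemma second_slice s i j T x x' : N T -> exists d, forall y y',
  inner (T (t (a s i x) (r j y))) (t (a s i x') (r j y')) = d * inner (r j y) y'.
Proof.
move=> NT; have bT : bounded_map T := vN_bounded graded_tensor_vN NT.
set u := a s i x; set u' := a s i x'.
have bt := tensor_right_bounded tH.
have [Y bY hY] := sesquilinear_slice (bt u) (bt u') bT.
have MY : M2 Y.
  apply/(vN_commutantP v2); split=> // B cB y; apply: inner_ext => y'; rewrite hY.
  have gB : graded_commuting id B by constructor 2.
  have [A' [B' [iA' BB' h]]] := graded_tensor_inner gB NT.
  have -> : t u (B y) = t (id u) (B y) by [].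
  rewrite h -(adjoint_unique (fun u v => erefl (inner u v)) iA') /=.
  by rewrite -hY BB'.
have zu w : z1 (a s i w) = (-1) ^+ s *: a s i w.
  rewrite /transfer (iter_grading_reflection c1 o1).
  by rewrite -(half_commute g1 o1 _ (or_introl (Mp i))) (reflection_half g1 o1).
have eY y : G2 (Y (G2 y)) = Y y.
  apply: inner_ext => y'; rewrite (grading_adjoint g2) !hY.
  have gz : graded_commuting z1 G2 by constructor 3.
  have [A' [B' [zA' GB' h]]] := graded_tensor_inner gz NT.
  have := h u y u' (G2 y').
  have -> : A' = z1 by apply: adjoint_unique zA' _; case: o1.
  have -> : B' = G2 by apply: adjoint_unique GB' _; exact: grading_adjoint g2.
  rewrite (gradingK g2) {1 2}/u {1 2}/u' !zu -/u -/u' !linearZl_LR /=.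
  rewrite (bmapZ bT) innerZl innerZr rmorphXn rmorphN rmorph1.
  by move=> /mulfI; apply; rewrite signr_eq0.
have [d hd] := double_minimal c2 o2 qab qeq qtot j MY eY.
have [_ rr _] := double_projection c2 o2 qab j.
by exists d => y y'; rewrite -innerZl -hd rr hY.
Qed.

(** By the two slices,
    [<T (a x (x) r y), a x' (x) r y'> = c(y, y') <a x, x'> = d(x, x') <r y, y'>],
    and such a form is a multiple of [<a x, x'> <r y, y'>]; the factor is read
    off at a vector [y0] with [r y0 <> 0]. *)
Lemma graded_tensor_minimal s i j P T :
  is_tensor_operator t (a s i) (r j) P -> N T ->
  exists c : R[i], forall w, P (T (P w)) = c *: P w.
Proof.
move=> hP NT; have bT : bounded_map T := vN_bounded graded_tensor_vN NT.
have bP : bounded_map P := hP.1.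
have [_ aa _] := transfer_projection c1 o1 pab s i.
have [_ rr rrr] := double_projection c2 o2 qab j.
have PP : is_adjoint P P := tensor_operator_adjoint tH hP hP aa rr.
have ext (c : R[i]) : (forall x y x' y',
    inner (T (t (a s i x) (r j y))) (t (a s i x') (r j y')) =
      c * (inner (a s i x) x' * inner (r j y) y')) ->
    forall w, P (T (P w)) = c *: P w.
  move=> h w; have bPTP : bounded_map (P \o (T \o P)).
    exact: bounded_map_comp (bounded_map_comp bP bT) bP.
  have e : P \o (T \o P) = (fun w => c *: P w).
    apply: (bounded_map_ext (total_tensor tH) bPTP (bounded_mapZ c bP)) => -[x y].
    apply: (total_inner_ext (total_tensor tH)) => -[x' y'] /=.
    by rewrite -PP !hP.2 inner_conj h [RHS]inner_conj innerZl tH.1.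
  exact: (congr1 (fun f => f w) e).
have [[y0 ry0]|/forallNP r0] := pselect (exists y0, r j y0 <> 0); last first.
  exists 0; apply: ext => x y x' y'.
  by have /contrapT -> := r0 y; rewrite inner0l mulr0 linear0r (bmap0 bT) inner0l mulr0.
have n0 : inner (r j y0) y0 != 0.
  apply/eqP; rewrite -rrr /= rr => h; apply: ry0; exact: inner_eq0.
have [c hc] := first_slice s i (r j y0) (r j y0) NT.
exists (c / inner (r j y0) y0); apply: ext => x y x' y'.
have [d hd] := second_slice s i j x x' NT.
rewrite hd mulrA; congr (_ * _).
have := hd y0 y0; rewrite hc => h.
by apply: (mulIf n0); rewrite -h mulrAC divfK.
Qed.

End GradedTensor.

(** * The matrix units of the graded tensor product *)

Section MatrixUnits.
Context {R : realType} {H1 H2 H : hilbertType R[i]}.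
Variable t : {bilinear H1 -> H2 -> H}.
Hypothesis tH : hilbert_tensor_product t.
Variables (M1 : set (H1 -> H1)) (G1 : H1 -> H1).
Variables (M2 : set (H2 -> H2)) (G2 : H2 -> H2).
Hypotheses (c1 : central_graded M1 G1) (c2 : central_graded M2 G2).

Local Notation N := (graded_tensor_product t M1 G1 M2 G2).

Lemma total_tensor_families (I J : Type) (a : I -> H1) (b : J -> H2) :
  total a -> total b -> total (fun ij : I * J => t (a ij.1) (b ij.2)).
Proof.
move=> ta tb W cW hW; apply: (total_tensor tH) => // -[x y] /=.
have := tb _ (closed_subspace_preimage (tensor_right_bounded tH x) cW); apply => j /=.
have bt := tensor_left_bounded tH (b j).
have := ta _ (closed_subspace_preimage bt cW); apply => i /=.
exact: (hW (i, j)).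
Qed.

Variables (z1 : H1 -> H1) (z2 : H2 -> H2).
Hypotheses (o1 : odd_reflection M1 G1 z1) (o2 : odd_reflection M2 G2 z2).

Lemma iter_reflection_even (s : bool) D y : M2 D ->
  (forall x, G2 (D (G2 x)) = D x) ->
  G2 (D (iter s z2 (G2 y))) = (-1) ^+ s *: D (iter s z2 y).
Proof.
move=> MD eD; have g2 : graded_von_neumann_algebra M2 G2 by case: c2.
have v2 : von_neumann_algebra M2 by case: g2.
have bD := vN_bounded v2 MD.
case: s => /=; last by rewrite eD expr0 scale1r.
rewrite (reflection_grading g2 o2) (bmapN bD) (bmapN (grading_bounded g2)) eD.
by rewrite expr1 scaleN1r.
Qed.

(** The partial isometry is [(G1^s' v e G1^s) (x) (double v' z2^tau)] with
    [tau = s + s' mod 2].  Its first factor is an element of [M1] times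
    [G1^tau] and its second one has degree [tau], as in the generators; on the
    second factor [z2^tau] cancels in both products. *)
Lemma equivalent_in_graded_tensor s s' (v w p p' : H1 -> H1) (v' w' q q' : H2 -> H2)
    (P P' : H -> H) :
  [/\ M1 v, M1 w, is_adjoint v w, w \o v = p & v \o w = p'] ->
  [/\ M2 v', M2 w', is_adjoint v' w', w' \o v' = q & v' \o w' = q'] ->
  is_tensor_operator t (transfer G1 z1 s s p) (double G2 z2 q) P ->
  is_tensor_operator t (transfer G1 z1 s' s' p') (double G2 z2 q') P' ->
  equivalent_projections N P P'.
Proof.
move=> [Mv Mw vw wv vwE] [Mv' Mw' vw' wv' vwE'] hP hP'.
have g1 : graded_von_neumann_algebra M1 G1 by case: c1.
have g2 : graded_von_neumann_algebra M2 G2 by case: c2.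
have v1 : von_neumann_algebra M1 by case: g1.
have v2 : von_neumann_algebra M2 by case: g2.
have Z2 : Defs.center M2 z2 by case: o2.
have z2K y : z2 (z2 y) = y by case: o2.
pose tau := s (+) s'.
have Mz : M2 (iter tau z2).
  by case: (tau) => /=; [case: Z2|exact: vN_id].
have cz : commutant M2 (iter tau z2).
  by case: (tau) => /=; [case: Z2|exact: (vN_id (commutant_of_vN v2))].
have zadj : is_adjoint (iter tau z2) (iter tau z2).
  by case: (tau) => //=; case: o2.
have zK y : iter tau z2 (iter tau z2 y) = y by case: (tau) => //=; rewrite z2K.
pose A := transfer G1 z1 s s' v; pose A' := transfer G1 z1 s' s w.
pose B := double G2 z2 v' \o iter tau z2; pose B' := iter tau z2 \o double G2 z2 w'.
have MB : M2 B by apply: vN_comp => //; exact: (double_in c2 o2).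
have MB' : M2 B' by apply: vN_comp => //; exact: (double_in c2 o2).
have bA : bounded_map A := transfer_bounded c1 o1 s s' (vN_bounded v1 Mv).
have bA' : bounded_map A' := transfer_bounded c1 o1 s' s (vN_bounded v1 Mw).
have [V hV] := tensor_operator_exists tH bA (vN_bounded v2 MB).
have [V' hV'] := tensor_operator_exists tH bA' (vN_bounded v2 MB').
have VV' : is_adjoint V V'.
  apply: (tensor_operator_adjoint tH hV hV').
    exact: (transfer_adjoint c1 o1).
  by apply: is_adjoint_comp => //; exact: (double_adjoint c2 o2).
have NV : N V.
  apply: (@graded_tensor_in _ _ _ _ t M1 G1 M2 G2 (transfer G1 z1 s' s' v) B tau).
  - exact: (transfer_in c1 o1).
  - split=> //; apply/funext => y; rewrite /Ad /B /=.
    apply: iter_reflection_even; first exact: (double_in c2 o2).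
    by move=> x; rewrite (double_even c2).
  - suff <- : A = transfer G1 z1 s' s' v \o iter tau G1 by [].
    by apply/funext => x; exact: (transfer_iter c1).
exists V, V'; split=> //.
- exact: (vN_adjoint (graded_tensor_vN t M1 G1 M2 G2) NV VV').
- apply: (tensor_operator_unique tH _ hP).
  have -> : transfer G1 z1 s s p = A' \o A.
    by apply/funext => x; rewrite /A' /A /= (transfer_comp c1 o1) // wv.
  have -> : double G2 z2 q = B' \o B; last exact: tensor_operator_comp.
  apply/funext => y; rewrite /B' /B /= (double_comp c2 o2) // wv'.
  have Mq : M2 q by rewrite -wv'; exact: vN_comp.
  by rewrite (vN_commute (double_in c2 o2 Mq) cz) zK.
- apply: (tensor_operator_unique tH _ hP').
  have -> : transfer G1 z1 s' s' p' = A \o A'.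
    by apply/funext => x; rewrite /A' /A /= (transfer_comp c1 o1) // vwE.
  have -> : double G2 z2 q' = B \o B'; last exact: tensor_operator_comp.
  by apply/funext => y; rewrite /B' /B /= zK (double_comp c2 o2) // vwE'.
Qed.

End MatrixUnits.

Theorem proposition3p14 (R : realType) (H1 H2 H : hilbertType R[i])
    (t : {bilinear H1 -> H2 -> H})
    (M1 : set (H1 -> H1)) (G1 : H1 -> H1)
    (M2 : set (H2 -> H2)) (G2 : H2 -> H2) (m n : Type) :
  hilbert_tensor_product t ->
  central_graded M1 G1 ->
  central_graded M2 G2 ->
  type_I m M1 -> ~ is_factor M1 ->
  type_I n M2 -> ~ is_factor M2 ->
  type_I (bool * m * n)%type (graded_tensor_product t M1 G1 M2 G2).
Proof.
move=> tH c1 c2 [v1 [p [pab po peq ps]]] nf1 [v2 [q [qab qo qeq qs]]] nf2.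
have g1 : graded_von_neumann_algebra M1 G1 by case: c1.
have g2 : graded_von_neumann_algebra M2 G2 by case: c2.
have [z1 o1] := odd_reflection_exists g1 c1 nf1.
have [z2 o2] := odd_reflection_exists g2 c2 nf2.
have ptot := total_of_sum ps; have qtot := total_of_sum qs.
have Mp i : M1 (p i) by case: (pab i).
have Mq j : M2 (q j) by case: (qab j).
have vN := graded_tensor_vN t M1 G1 M2 G2.
pose a (si : bool * m) := transfer G1 z1 si.1 si.1 (p si.2).
pose r j := double G2 z2 (q j).
have ta : total (fun six : (bool * m) * H1 => a six.1 six.2).
  exact: (transfer_total c1 o1 pab ptot).
have tr : total (fun jy : n * H2 => r jy.1 jy.2).
  exact: (double_total c2 o2 qab qtot).
have aP si : projection (a si) by exact: (transfer_projection c1 o1 pab).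
have rP j : projection (r j) by exact: (double_projection c2 o2 qab).
(* the [bool] index records on which of the two central summands of [M1] the
   corner lives *)
have /choice[P hP] : forall k : {classic (bool * m * n)%type}, exists T,
    is_tensor_operator t (a k.1) (r k.2) T.
  move=> k; apply: (tensor_operator_exists tH).
    by case: (aP k.1).
  by case: (rP k.2).
have NP k : graded_tensor_product t M1 G1 M2 G2 (P k).
  apply: (@graded_tensor_in _ _ _ _ t M1 G1 M2 G2 (a k.1) (r k.2) false).
  - exact: (transfer_in c1 o1).
  - split; first exact: (double_in c2 o2).
    by apply/funext => y; rewrite /Ad /= expr0 scale1r (double_even c2).
  - exact: hP.
have prP k : projection (P k).
  split; first exact: (hP k).1.
  - apply: (tensor_operator_adjoint tH (hP k) (hP k)).
      by case: (aP k.1).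
    by case: (rP k.2).
  - apply: (tensor_operator_unique tH (tensor_operator_comp (hP k) (hP k))).
    by case: (aP k.1) => _ _ ->; case: (rP k.2) => _ _ ->; exact: hP.
have orP k l : k <> l -> P k \o P l = (fun=> 0).
  move=> kl; have hkl := tensor_operator_comp (hP k) (hP l).
  apply: (tensor_operator_unique tH hkl); split.
    have := bounded_mapZ 0 (hkl.1 : bounded_map _).
    by congr bounded_map; apply/funext => w; rewrite scale0r.
  move=> x y; have [e|e] := pselect (k.1 = l.1); last first.
    have -> : a k.1 \o a l.1 = (fun=> 0).
      apply: (transfer_orthogonal c1 o1 pab po) => h; apply: e.
      by move: h; rewrite -!surjective_pairing.
    by rewrite linear0l.
  have -> : r k.2 \o r l.2 = (fun=> 0); last by rewrite linear0r.
  apply: (double_orthogonal c2 o2 qab qo) => h; apply: kl.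
  by move: e h; case: (k) (l) => [? ?] [? ?] /= -> ->.
split=> //; exists P; split.
- move=> k; split=> // A B NA NB.
  have minP := graded_tensor_minimal tH c1 c2 o1 o2 pab peq ptot qab qeq qtot (hP k).
  have [c hc] := minP A NA; have [d hd] := minP B NB.
  have PK w : P k (P k w) = P k w.
    by case: (prP k) => _ _ e; exact: (congr1 (fun f => f w) e).
  apply/funext => w /=; rewrite !PK.
  by rewrite [LHS]hc [in LHS]hd [RHS]hd hc !scalerA mulrC.
- exact: orP.
- move=> k l; have [v [w hvw]] := peq k.1.2 l.1.2.
  have [v' [w' hvw']] := qeq k.2 l.2.
  exact: (equivalent_in_graded_tensor tH c1 c2 o1 o2 hvw hvw' (hP k) (hP l)).
- apply: (sum_of_total prP orP) => W cW hW.
  apply: (total_tensor_families tH ta tr) => // -[[si x] [j y]] /=.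
  rewrite -(hP (si, j)).2.
  exact: (hW ((si, j), _)).
Qed.
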